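(* Let $H=\mathcal{P}(G,R,D)$ be the pointed Hopf algebra defined in the context, with skew-primitive generators $x_1,\dots,x_n$, and let $u:H\to A$ define an inner action of $H$ on a matrix algebra $A$ over $\mathbb{F}$. Then for each $i=1,\dots,n$ there is a function $\lambda_i:G\to\mathbb{F}$ such that for every $g\in G$ $$u(g)u(x_i)u(g)^{-1}=\chi_i(g)\,u(x_i)+\lambda_i(g)\,u(a_i).$$ Moreover, one can choose $u$, the action remaining the same, so that all $\lambda_i(g)=0$, that is, $$u(g)u(x_i)=\chi_i(g)\,u(x_i)u(g)\quad\text{for all } g\in G \text{ and all } i.$$
   Context: Let $\mathbb{F}$ be a field, $G$ a finite nontrivial abelian group, $\widehat{G}=\mathrm{Hom}(G,\mathbb{F}^\times)$ with $|\widehat{G}|=|G|$, and $\varepsilon$ the trivial character. Let $a_1,\dots,a_n\in G$, $\chi_1,\dots,\chi_n\in\widehat{G}$ satisfy $q_i:=\chi_i(a_i)\neq1$ for all $i$ and $\chi_j(a_i)\chi_i(a_j)=1$ for $i\ne j$ (the datum of a quantum linear space $R$ of rank $n$). Let $N_i$ be the order of $q_i$ in $\mathbb{F}^\times$. A compatible datum $D$ consists of $\mu_i\in\{0,1\}$ and $\lambda_{ij}\in\mathbb{F}$ ($1\le i<j\le n$) such that $\mu_i=0$ if $a_i^{N_i}=1$ or $\chi_i^{N_i}\ne\varepsilon$, and $\lambda_{ij}=0$ if $a_ia_j=1$ or $\chi_i\chi_j\neq\varepsilon$. The Hopf algebra $\mathcal{P}(G,R,D)$ is generated by $G$ and $x_1,\dots,x_n$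 subject to the relations of $G$ and: $gx_i=\chi_i(g)x_ig$ for $g\in G$; $x_i^{N_i}=\mu_i(1-a_i^{N_i})$; $x_jx_i=\chi_i(a_j)x_ix_j+\lambda_{ij}(1-a_ia_j)$ for $i<j$; with $\Delta(g)=g\otimes g$ for $g\in G$ and $\Delta(x_i)=x_i\otimes1+a_i\otimes x_i$. An action of $H$ on $A$ is an $H$-module algebra structure $(h,a)\mapsto h*a$. It is inner, via a convolution invertible linear map $u:H\to A$ normalized by $u(1)=1_A$, if $h*a=\sum u(h_{(1)})\,a\,u^{-1}(h_{(2)})$, with $u^{-1}$ the convolution inverse; thus $g*a=u(g)au(g)^{-1}$ and $x_i*a=u(x_i)a-u(a_i)au(a_i)^{-1}u(x_i)$. *)

(* Defs.v *)
From HB Require Import structures.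
From mathcomp Require Import all_boot all_order all_fingroup all_algebra.
From mathcomp Require Import cyclic ring generic_quotient boolp.

Set Implicit Arguments.
Unset Strict Implicit.
Unset Printing Implicit Defensive.

Import GRing.Theory.
Local Open Scope ring_scope.
Local Open Scope quotient_scope.

(* Tensor product of vector spaces: formal linear combinations of symbols
   a (x) b modulo the smallest congruence containing the vector space axioms
   and bilinearity. *)

Section TensorProduct.
Variables (F : fieldType) (A B : lmodType F).

Inductive tterm : Type :=
| TZero
| TPure of A & B
| TAdd of tterm & tterm
| TScale of F & tterm.

Inductive teq : tterm -> tterm -> Prop :=
| teq_refl t : teq t t
| teq_sym s t : teq s t -> teq t s
| teq_trans s t r : teq s t -> teq t r -> teq s r
| teq_add s s' t t' : teq s s' -> teq t t' -> teq (TAdd s t) (TAdd s' t')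
| teq_scale c t t' : teq t t' -> teq (TScale c t) (TScale c t')
| teq_addA s t r : teq (TAdd s (TAdd t r)) (TAdd (TAdd s t) r)
| teq_addC s t : teq (TAdd s t) (TAdd t s)
| teq_add0 t : teq (TAdd TZero t) t
| teq_scaleA c d t : teq (TScale c (TScale d t)) (TScale (c * d) t)
| teq_scale1 t : teq (TScale 1 t) t
| teq_scale0 t : teq (TScale 0 t) TZero
| teq_scaleDr c s t : teq (TScale c (TAdd s t)) (TAdd (TScale c s) (TScale c t))
| teq_scaleDl c d t : teq (TScale (c + d) t) (TAdd (TScale c t) (TScale d t))
| teq_pureDl a a' b : teq (TPure (a + a') b) (TAdd (TPure a b) (TPure a' b))
| teq_pureDr a b b' : teq (TPure a (b + b')) (TAdd (TPure a b) (TPure a b'))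
| teq_pureZl c a b : teq (TPure (c *: a) b) (TScale c (TPure a b))
| teq_pureZr c a b : teq (TPure a (c *: b)) (TScale c (TPure a b)).

HB.instance Definition _ := gen_eqMixin tterm.
HB.instance Definition _ := gen_choiceMixin tterm.

Definition teqb (s t : tterm) : bool := `[< teq s t >].

Lemma teqb_refl : reflexive teqb.
Proof. by move=> t; apply/asboolP/teq_refl. Qed.
Lemma teqb_sym : symmetric teqb.
Proof. by move=> s t; apply: asbool_equiv_eq; split=> /teq_sym. Qed.
Lemma teqb_trans : transitive teqb.
Proof. by move=> s t r /asboolP ts /asboolP sr; apply/asboolP/(teq_trans ts sr). Qed.

Canonical teqb_equiv := EquivRel teqb teqb_refl teqb_sym teqb_trans.

Definition tensor : Type := {eq_quot teqb}.
HB.instance Definition _ := Choice.on tensor.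

Let tpi (t : tterm) : tensor := \pi_{eq_quot teqb} t.

Lemma tpiP s t : tpi s = tpi t <-> teq s t.
Proof. by split=> [/eqmodP/asboolP|st]; last apply/eqmodP/asboolP. Qed.

Lemma trepr (t : tensor) : tpi (repr t) = t.
Proof. exact: reprK. Qed.

Lemma teq_repr t : teq (repr (tpi t)) t.
Proof. by apply/tpiP; rewrite trepr. Qed.

Definition tpure (a : A) (b : B) : tensor := tpi (TPure a b).
Definition tzero : tensor := tpi TZero.
Definition tadd (s t : tensor) : tensor := tpi (TAdd (repr s) (repr t)).
Definition tscale (c : F) (t : tensor) : tensor := tpi (TScale c (repr t)).

Lemma tpi_add s t : tpi (TAdd s t) = tadd (tpi s) (tpi t).
Proof. by apply/tpiP/teq_sym/teq_add; apply: teq_repr. Qed.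
Lemma tpi_scale c t : tpi (TScale c t) = tscale c (tpi t).
Proof. by apply/tpiP/teq_sym/teq_scale/teq_repr. Qed.

Lemma taddA : associative tadd.
Proof.
move=> s t r; rewrite -(trepr s) -(trepr t) -(trepr r) -!tpi_add.
exact/tpiP/teq_addA.
Qed.
Lemma taddC : commutative tadd.
Proof.
by move=> s t; rewrite -(trepr s) -(trepr t) -!tpi_add; apply/tpiP/teq_addC.
Qed.
Lemma tadd0 : left_id tzero tadd.
Proof. by move=> t; rewrite -(trepr t) -tpi_add; apply/tpiP/teq_add0. Qed.
Lemma tscaleA c d t : tscale c (tscale d t) = tscale (c * d) t.
Proof. by rewrite -(trepr t) -!tpi_scale; apply/tpiP/teq_scaleA. Qed.
Lemma tscale1 : left_id 1 tscale.
Proof. by move=> t; rewrite -(trepr t) -!tpi_scale; apply/tpiP/teq_scale1. Qed.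
Lemma tscale0 t : tscale 0 t = tzero.
Proof. by rewrite -(trepr t) -!tpi_scale; apply/tpiP/teq_scale0. Qed.
Lemma tscaleDr : right_distributive tscale tadd.
Proof.
move=> c s t; rewrite -(trepr s) -(trepr t) -!(tpi_add, tpi_scale).
exact/tpiP/teq_scaleDr.
Qed.
Lemma tscaleDl t c d : tscale (c + d) t = tadd (tscale c t) (tscale d t).
Proof.
by rewrite -(trepr t) -!(tpi_add, tpi_scale); apply/tpiP/teq_scaleDl.
Qed.
Lemma taddN : left_inverse tzero (tscale (-1)) tadd.
Proof. by move=> t; rewrite -{2}(tscale1 t) -tscaleDl addNr tscale0. Qed.

HB.instance Definition _ :=
  GRing.isZmodule.Build tensor taddA taddC tadd0 taddN.
HB.instance Definition _ :=
  GRing.Zmodule_isLmodule.Build F tensor tscaleA tscale1 tscaleDr tscaleDl.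

Lemma tpureDl a a' b : tpure (a + a') b = tpure a b + tpure a' b.
Proof. by rewrite [RHS]/GRing.add /= -tpi_add; apply/tpiP/teq_pureDl. Qed.
Lemma tpureDr a b b' : tpure a (b + b') = tpure a b + tpure a b'.
Proof. by rewrite [RHS]/GRing.add /= -tpi_add; apply/tpiP/teq_pureDr. Qed.
Lemma tpureZl c a b : tpure (c *: a) b = c *: tpure a b.
Proof. by rewrite [RHS]/GRing.scale /= -tpi_scale; apply/tpiP/teq_pureZl. Qed.
Lemma tpureZr c a b : tpure a (c *: b) = c *: tpure a b.
Proof. by rewrite [RHS]/GRing.scale /= -tpi_scale; apply/tpiP/teq_pureZr. Qed.

Lemma tpureNl a b : tpure (- a) b = - tpure a b.
Proof. by rewrite -scaleN1r tpureZl scaleN1r. Qed.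
Lemma tpureNr a b : tpure a (- b) = - tpure a b.
Proof. by rewrite -scaleN1r tpureZr scaleN1r. Qed.

Lemma tensor_ind (P : tensor -> Prop) :
    P 0 -> (forall a b, P (tpure a b)) ->
    (forall s t, P s -> P t -> P (s + t)) ->
  forall t, P t.
Proof.
move=> P0 Pp PD t; rewrite -(trepr t); suff : forall c, P (c *: tpi (repr t)).
  by move/(_ 1); rewrite scale1r.
elim: (repr t) => [|a b|r IHr s IHs|d s IHs] c.
- by rewrite (_ : tpi _ = 0) ?scaler0.
- by rewrite -[tpi _]/(tpure a b) -tpureZl.
- by rewrite tpi_add scalerDr; apply: PD.
- by rewrite tpi_scale scalerA.
Qed.

Definition bilinear_map (V : lmodType F) (f : A -> B -> V) : Prop :=
  (forall b, linear (f^~ b)) /\ (forall a, linear (f a)).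

Fixpoint teval (V : lmodType F) (f : A -> B -> V) (t : tterm) : V :=
  match t with
  | TZero => 0
  | TPure a b => f a b
  | TAdd s r => teval f s + teval f r
  | TScale c s => c *: teval f s
  end.

(* For a tensor t = \sum a_k (x) b_k, [tlift f t] is \sum f a_k b_k.  It is
   only meaningful for bilinear f (the representative of t is then irrelevant,
   see [tlift_tpure], [tlift_linear]); taking f as a bare function makes
   [tlift (fun h1 h2 => _) (comul h)] read as Sweedler notation. *)
Definition tlift (V : lmodType F) (f : A -> B -> V) (t : tensor) : V :=
  teval f (repr t).

Lemma teval_teq (V : lmodType F) (f : A -> B -> V) s t :
  bilinear_map f -> teq s t -> teval f s = teval f t.
Proof.
move=> [fl fr]; elim=> {s t} //=.
- by move=> s t r _ -> _ ->.
- by move=> s s' t t' _ -> _ ->.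
- by move=> c t t' _ ->.
- by move=> s t r; rewrite addrA.
- by move=> s t; rewrite addrC.
- by move=> t; rewrite add0r.
- by move=> c d t; rewrite scalerA.
- by move=> t; rewrite scale1r.
- by move=> t; rewrite scale0r.
- by move=> c s t; rewrite scalerDr.
- by move=> c d t; rewrite scalerDl.
- by move=> a a' b; have := fl b 1 a a'; rewrite !scale1r.
- by move=> a b b'; have := fr a 1 b b'; rewrite !scale1r.
- move=> c a b; have f0 : f 0 b = 0.
    by have := fl b (-1) 0 0; rewrite scaler0 addr0 scaleN1r addNr.
  by have := fl b c a 0; rewrite !addr0 f0 addr0.
- move=> c a b; have f0 : f a 0 = 0.
    by have := fr a (-1) 0 0; rewrite scaler0 addr0 scaleN1r addNr.
  by have := fr a c b 0; rewrite !addr0 f0 addr0.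
Qed.

Lemma tlift_tpure (V : lmodType F) (f : A -> B -> V) a b :
  bilinear_map f -> tlift f (tpure a b) = f a b.
Proof. by move=> fB; rewrite /tlift (teval_teq fB (teq_repr _)). Qed.

Lemma tlift_linear (V : lmodType F) (f : A -> B -> V) :
  bilinear_map f -> linear (tlift f).
Proof.
move=> fB c s t; rewrite /tlift -/(teval f (TScale c (repr s))).
rewrite -/(teval f (TAdd (TScale c (repr s)) (repr t))).
apply: teval_teq => //; apply/tpiP; rewrite trepr.
by rewrite tpi_add tpi_scale !trepr.
Qed.

Lemma tliftD (V : lmodType F) (f : A -> B -> V) s t :
  bilinear_map f -> tlift f (s + t) = tlift f s + tlift f t.
Proof. by move=> fB; have := tlift_linear fB 1 s t; rewrite !scale1r. Qed.

Lemma tlift0 (V : lmodType F) (f : A -> B -> V) :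
  bilinear_map f -> tlift f 0 = 0.
Proof.
by move=> fB; apply: (addrI (tlift f 0)); rewrite -tliftD // !addr0.
Qed.

Lemma tliftZ (V : lmodType F) (f : A -> B -> V) c t :
  bilinear_map f -> tlift f (c *: t) = c *: tlift f t.
Proof.
by move=> fB; have := tlift_linear fB c t 0; rewrite !(tlift0, addr0).
Qed.

Lemma tlift_fun_linear (V : lmodType F) (f g h : A -> B -> V) c t :
    (forall a b, h a b = c *: f a b + g a b) ->
  tlift h t = c *: tlift f t + tlift g t.
Proof.
move=> hE; rewrite /tlift; elim: (repr t) => [|a b|r IHr s IHs|d s IHs] /=.
- by rewrite scaler0 addr0.
- exact: hE.
- by rewrite IHr IHs scalerDr addrACA.
- by rewrite IHs scalerDr !scalerA mulrC.
Qed.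

Lemma eq_tlift (V : lmodType F) (f g : A -> B -> V) t :
  (forall a b, f a b = g a b) -> tlift f t = tlift g t.
Proof.
move=> fg; rewrite /tlift; elim: (repr t) => [|a b|r IHr s IHs|d s IHs] //=.
- by rewrite IHr IHs.
- by rewrite IHs.
Qed.

Lemma tlift_comp (V W : lmodType F) (f : A -> B -> V) (k : V -> W) t :
  linear k -> k (tlift f t) = tlift (fun a b => k (f a b)) t.
Proof.
move=> kl; have kD u v : k (u + v) = k u + k v.
  by have := kl 1 u v; rewrite !scale1r.
have k0 : k 0 = 0 by apply: (addrI (k 0)); rewrite -kD !addr0.
rewrite /tlift; elim: (repr t) => [|a b|r IHr s IHs|d s IHs] //=.
- by rewrite kD IHr IHs.
- by rewrite -IHs; have := kl d (teval f s) 0; rewrite !addr0 k0 addr0.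
Qed.

Lemma tpure_bilinear : bilinear_map tpure.
Proof.
split=> [b c x y|a c x y] /=; first by rewrite tpureDl tpureZl.
by rewrite tpureDr tpureZr.
Qed.

End TensorProduct.

Arguments TZero {F A B}.

Notation "a \ox b" := (tpure a b) (at level 40, left associativity) : ring_scope.

Section TensorMul.
Variables (F : fieldType) (A B : lmodType F).
Variables (mA : A -> A -> A) (mB : B -> B -> B).
Implicit Types (s t r : tensor A B).

Definition tmulp (a : A) (b : B) (t : tensor A B) : tensor A B :=
  tlift (fun c d => mA a c \ox mB b d) t.
Definition tmul s t : tensor A B := tlift (fun a b => tmulp a b t) s.

Hypotheses (mAB : bilinear_map mA) (mBB : bilinear_map mB).

Lemma tmulp_bilin a b : bilinear_map (fun c d => mA a c \ox mB b d).
Proof.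
split=> [d k x y|c k x y].
  by rewrite mAB.2 tpureDl tpureZl.
by rewrite mBB.2 tpureDr tpureZr.
Qed.

Lemma tmul_bilin_fun t : bilinear_map (fun a b => tmulp a b t).
Proof.
split=> [d k x y|c k x y]; rewrite /tmulp /=; apply: tlift_fun_linear => a b.
  by rewrite mAB.1 tpureDl tpureZl.
by rewrite mBB.1 tpureDr tpureZr.
Qed.

Lemma tmulE a b c d : tmul (a \ox b) (c \ox d) = mA a c \ox mB b d.
Proof.
rewrite /tmul tlift_tpure; last exact: tmul_bilin_fun.
by rewrite /tmulp tlift_tpure //; apply: tmulp_bilin.
Qed.

Lemma tmul_bilin : bilinear_map tmul.
Proof.
split=> [t|s] c x y; first exact: (tlift_linear (tmul_bilin_fun t)).
apply: tlift_fun_linear => a b.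
exact: (tlift_linear (tmulp_bilin a b)).
Qed.

Lemma tlift_tmul (V : lmodType F) (mV : V -> V -> V) (f g h : A -> B -> V) :
    bilinear_map mV -> bilinear_map f -> bilinear_map g -> bilinear_map h ->
    (forall a b a' b', h (mA a a') (mB b b') = mV (f a b) (g a' b')) ->
  forall s t, tlift h (tmul s t) = mV (tlift f s) (tlift g t).
Proof.
move=> mVB fB gB hB hE s t.
rewrite (tlift_comp _ s (mVB.1 (tlift g t))) /tmul (tlift_comp _ s (tlift_linear hB)).
apply: eq_tlift => a b; rewrite (tlift_comp _ t (mVB.2 (f a b))).
rewrite /tmulp (tlift_comp _ t (tlift_linear hB)).
by apply: eq_tlift => c d; rewrite tlift_tpure.
Qed.

End TensorMul.

Section TensorAlgebra.
Variables (F : fieldType) (A B : algType F).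
Implicit Types (s t r : tensor A B).

Lemma mul_bilin (C : algType F) : bilinear_map (@GRing.mul C).
Proof.
split=> [b c x y|a c x y] /=; first by rewrite mulrDl scalerAl.
by rewrite mulrDr scalerAr.
Qed.

Local Notation tmul := (@tmul F A B *%R *%R).
Let tB : bilinear_map tmul := tmul_bilin (mul_bilin A) (mul_bilin B).
Let tE a b c d : tmul (a \ox b) (c \ox d) = (a * c) \ox (b * d)
  := tmulE (mul_bilin A) (mul_bilin B) a b c d.

Definition tone : tensor A B := 1 \ox 1.

Lemma tmulDl : left_distributive tmul +%R.
Proof. by move=> s t r; have := tB.1 r 1 s t; rewrite !scale1r. Qed.

Lemma tmulDr : right_distributive tmul +%R.
Proof. by move=> s t r; have := tB.2 s 1 t r; rewrite !scale1r. Qed.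

Lemma tmul0l t : tmul 0 t = 0.
Proof. by apply: (addrI (tmul 0 t)); rewrite -tmulDl !addr0. Qed.
Lemma tmul0r s : tmul s 0 = 0.
Proof. by apply: (addrI (tmul s 0)); rewrite -tmulDr !addr0. Qed.

Lemma tmulA : associative tmul.
Proof.
move=> s t r.
elim/tensor_ind: s => [|a b|s s' IHs IHs'].
- by rewrite !tmul0l.
- elim/tensor_ind: t => [|c d|t t' IHt IHt'].
  + by rewrite !(tmul0l, tmul0r).
  + elim/tensor_ind: r => [|x y|r r' IHr IHr'].
    * by rewrite !tmul0r.
    * by rewrite !tE !mulrA.
    * by rewrite !tmulDr IHr IHr'.
  + by rewrite !(tmulDl, tmulDr) IHt IHt'.
- by rewrite !tmulDl IHs IHs'.
Qed.

Lemma tmul1 : left_id tone tmul.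
Proof.
elim/tensor_ind=> [|a b|s t IHs IHt]; first by rewrite tmul0r.
  by rewrite tE !mul1r.
by rewrite tmulDr IHs IHt.
Qed.
Lemma tmulr1 : right_id tone tmul.
Proof.
elim/tensor_ind=> [|a b|s t IHs IHt]; first by rewrite tmul0l.
  by rewrite tE !mulr1.
by rewrite tmulDl IHs IHt.
Qed.

HB.instance Definition _ :=
  GRing.Zmodule_isPzRing.Build (tensor A B) tmulA tmul1 tmulr1 tmulDl tmulDr.

Lemma tensorM a b c d :
  (a \ox b) * (c \ox d) = (a * c) \ox (b * d) :> tensor A B.
Proof. exact: tE. Qed.

Lemma tensor1 : 1 = 1 \ox 1 :> tensor A B.
Proof. by []. Qed.

Lemma tensorAl c s t : c *: (s * t) = (c *: s) * t.
Proof. by have := tB.1 t c s 0; rewrite !addr0 tmul0l addr0. Qed.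

Lemma tensorAr c s t : c *: (s * t) = s * (c *: t).
Proof. by have := tB.2 s c t 0; rewrite !addr0 tmul0r addr0. Qed.

Lemma tensorX a b k : (a \ox b) ^+ k = (a ^+ k) \ox (b ^+ k) :> tensor A B.
Proof. by elim: k => [|k IHk] //; rewrite !exprS IHk tensorM. Qed.

End TensorAlgebra.

(* Algebras given by generators and relations: noncommutative polynomial
   expressions in the generators modulo the smallest congruence containing the
   axioms of unital associative algebras and the given relations. *)

Inductive aterm (F X : Type) : Type :=
| AVar of X
| AConst of F
| AAdd of aterm F X & aterm F X
| AMul of aterm F X & aterm F X.

Declare Scope aterm_scope.
Delimit Scope aterm_scope with A.
Bind Scope aterm_scope with aterm.
Arguments AVar {F X} _.
Arguments AConst {F X} _.
Notation "s + t" := (AAdd s t) : aterm_scope.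
Notation "s * t" := (AMul s t) : aterm_scope.

Section PresentedAlgebra.
Variables (F : fieldType) (X : Type) (R : aterm F X -> aterm F X -> Prop).

Inductive aeq : aterm F X -> aterm F X -> Prop :=
| aeq_rel s t : R s t -> aeq s t
| aeq_refl t : aeq t t
| aeq_sym s t : aeq s t -> aeq t s
| aeq_trans s t r : aeq s t -> aeq t r -> aeq s r
| aeq_add s s' t t' : aeq s s' -> aeq t t' -> aeq (s + t)%A (s' + t')%A
| aeq_mul s s' t t' : aeq s s' -> aeq t t' -> aeq (s * t)%A (s' * t')%A
| aeq_addA s t r : aeq (s + (t + r))%A ((s + t) + r)%A
| aeq_addC s t : aeq (s + t)%A (t + s)%A
| aeq_add0 t : aeq (AConst 0 + t)%A t
| aeq_mulA s t r : aeq (s * (t * r))%A ((s * t) * r)%A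
| aeq_mul1 t : aeq (AConst 1 * t)%A t
| aeq_mul0 t : aeq (AConst 0 * t)%A (AConst 0)
| aeq_mulDl s t r : aeq ((s + t) * r)%A (s * r + t * r)%A
| aeq_mulDr s t r : aeq (s * (t + r))%A (s * t + s * r)%A
| aeq_constD c d : aeq (AConst (c + d)) (AConst c + AConst d)%A
| aeq_constM c d : aeq (AConst (c * d)) (AConst c * AConst d)%A
| aeq_constC c t : aeq (AConst c * t)%A (t * AConst c)%A.

HB.instance Definition _ := gen_eqMixin (aterm F X).
HB.instance Definition _ := gen_choiceMixin (aterm F X).

Definition aeqb (s t : aterm F X) : bool := `[< aeq s t >].

Lemma aeqb_refl : reflexive aeqb.
Proof. by move=> t; apply/asboolP/aeq_refl. Qed.
Lemma aeqb_sym : symmetric aeqb.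
Proof. by move=> s t; apply: asbool_equiv_eq; split=> /aeq_sym. Qed.
Lemma aeqb_trans : transitive aeqb.
Proof. by move=> s t r /asboolP ts /asboolP sr; apply/asboolP/(aeq_trans ts sr). Qed.

Canonical aeqb_equiv := EquivRel aeqb aeqb_refl aeqb_sym aeqb_trans.

Definition palg : Type := {eq_quot aeqb}.
HB.instance Definition _ := Choice.on palg.

Definition palg_pi (t : aterm F X) : palg := \pi_{eq_quot aeqb} t.
Local Notation api := palg_pi.

Lemma palg_piP s t : api s = api t <-> aeq s t.
Proof. by split=> [/eqmodP/asboolP|st]; last apply/eqmodP/asboolP. Qed.

Lemma palg_repr (t : palg) : api (repr t) = t.
Proof. exact: reprK. Qed.

Lemma aeq_repr t : aeq (repr (api t)) t.
Proof. by apply/palg_piP; rewrite palg_repr. Qed.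

Definition palg_gen (x : X) : palg := api (AVar x).
Definition palg_add (s t : palg) : palg := api (repr s + repr t)%A.
Definition palg_mul (s t : palg) : palg := api (repr s * repr t)%A.
Definition palg_opp (t : palg) : palg := palg_mul (api (AConst (-1))) t.
Definition palg_scale (c : F) (t : palg) : palg := palg_mul (api (AConst c)) t.

Lemma api_add s t : api (s + t)%A = palg_add (api s) (api t).
Proof. by apply/palg_piP/aeq_sym/aeq_add; apply: aeq_repr. Qed.
Lemma api_mul s t : api (s * t)%A = palg_mul (api s) (api t).
Proof. by apply/palg_piP/aeq_sym/aeq_mul; apply: aeq_repr. Qed.

Let apiE := (api_add, api_mul).

Lemma palg_addA : associative palg_add.
Proof.
move=> s t r; rewrite -(palg_repr s) -(palg_repr t) -(palg_repr r) -!apiE.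
exact/palg_piP/aeq_addA.
Qed.
Lemma palg_addC : commutative palg_add.
Proof.
move=> s t; rewrite -(palg_repr s) -(palg_repr t) -!apiE.
exact/palg_piP/aeq_addC.
Qed.
Lemma palg_add0 : left_id (api (AConst 0)) palg_add.
Proof.
by move=> t; rewrite -(palg_repr t) -!apiE; apply/palg_piP/aeq_add0.
Qed.
Lemma palg_mulA : associative palg_mul.
Proof.
move=> s t r; rewrite -(palg_repr s) -(palg_repr t) -(palg_repr r) -!apiE.
exact/palg_piP/aeq_mulA.
Qed.
Lemma palg_mul1 : left_id (api (AConst 1)) palg_mul.
Proof.
by move=> t; rewrite -(palg_repr t) -!apiE; apply/palg_piP/aeq_mul1.
Qed.
Lemma palg_constC c t : palg_mul (api (AConst c)) t = palg_mul t (api (AConst c)).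
Proof.
by rewrite -(palg_repr t) -!apiE; apply/palg_piP/aeq_constC.
Qed.
Lemma palg_mulr1 : right_id (api (AConst 1)) palg_mul.
Proof. by move=> t; rewrite -palg_constC palg_mul1. Qed.
Lemma palg_mul0 t : palg_mul (api (AConst 0)) t = api (AConst 0).
Proof. by rewrite -(palg_repr t) -!apiE; apply/palg_piP/aeq_mul0. Qed.
Lemma palg_mulDl : left_distributive palg_mul palg_add.
Proof.
move=> s t r; rewrite -(palg_repr s) -(palg_repr t) -(palg_repr r) -!apiE.
exact/palg_piP/aeq_mulDl.
Qed.
Lemma palg_mulDr : right_distributive palg_mul palg_add.
Proof.
move=> s t r; rewrite -(palg_repr s) -(palg_repr t) -(palg_repr r) -!apiE.
exact/palg_piP/aeq_mulDr.
Qed.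
Lemma palg_constD c d :
  api (AConst (c + d)) = palg_add (api (AConst c)) (api (AConst d)).
Proof. by rewrite -!apiE; apply/palg_piP/aeq_constD. Qed.
Lemma palg_constM c d :
  api (AConst (c * d)) = palg_mul (api (AConst c)) (api (AConst d)).
Proof. by rewrite -!apiE; apply/palg_piP/aeq_constM. Qed.
Lemma palg_addN : left_inverse (api (AConst 0)) palg_opp palg_add.
Proof.
move=> t; rewrite /palg_opp -{2}(palg_mul1 t) -palg_mulDl -palg_constD addNr.
exact: palg_mul0.
Qed.

HB.instance Definition _ :=
  GRing.isZmodule.Build palg palg_addA palg_addC palg_add0 palg_addN.
HB.instance Definition _ := GRing.Zmodule_isPzRing.Build palg
  palg_mulA palg_mul1 palg_mulr1 palg_mulDl palg_mulDr.

Lemma palg_scaleA c d t : palg_scale c (palg_scale d t) = palg_scale (c * d) t.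
Proof. by rewrite /palg_scale palg_constM palg_mulA. Qed.
Lemma palg_scaleDl t c d :
  palg_scale (c + d) t = palg_scale c t + palg_scale d t.
Proof. by rewrite /palg_scale palg_constD palg_mulDl. Qed.

HB.instance Definition _ := GRing.Zmodule_isLmodule.Build F palg
  palg_scaleA palg_mul1 (fun c => palg_mulDr (api (AConst c))) palg_scaleDl.

Lemma palg_scaleAl c (s t : palg) : c *: (s * t) = c *: s * t.
Proof. exact: palg_mulA. Qed.
Lemma palg_scaleAr c (s t : palg) : c *: (s * t) = s * (c *: t).
Proof.
rewrite [LHS]palg_mulA palg_constC.
exact/esym/palg_mulA.
Qed.

Lemma palg_piD s t : api (s + t)%A = api s + api t.
Proof. exact: api_add. Qed.
Lemma palg_piM s t : api (s * t)%A = api s * api t.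
Proof. exact: api_mul. Qed.
Lemma palg_piC c : api (AConst c) = c *: (1 : palg).
Proof. by rewrite [RHS]palg_constC [RHS]palg_mul1. Qed.

Lemma palg_ind (P : palg -> Prop) :
    (forall x, P (palg_gen x)) -> (forall c, P (c *: (1 : palg))) ->
    (forall s t, P s -> P t -> P (s + t)) ->
    (forall s t, P s -> P t -> P (s * t)) ->
  forall t, P t.
Proof.
move=> Px Pc PD PM t; rewrite -(palg_repr t).
elim: (repr t) => [x|c|r IHr s IHs|r IHr s IHs]; first exact: Px.
- by rewrite palg_piC.
- by rewrite palg_piD; apply: PD.
- by rewrite palg_piM; apply: PM.
Qed.

(* The universal property; the scalars of the target ring T are given by a
   ring morphism iota from F to the center of T. *)
Section Lift.
Variables (T : pzRingType) (iota : F -> T) (f : X -> T).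

Definition central_morphism : Prop :=
  [/\ iota 1 = 1, {morph iota : c d / c + d}, {morph iota : c d / c * d}
    & forall c t, iota c * t = t * iota c].

Fixpoint aeval (t : aterm F X) : T :=
  match t with
  | AVar x => f x
  | AConst c => iota c
  | AAdd s r => aeval s + aeval r
  | AMul s r => aeval s * aeval r
  end.

Definition palg_lift (t : palg) : T := aeval (repr t).

Hypothesis iotaP : central_morphism.
Hypothesis relP : forall s t, R s t -> aeval s = aeval t.

Lemma aeval_aeq s t : aeq s t -> aeval s = aeval t.
Proof.
have [i1 iD iM iC] := iotaP.
have i0 : iota 0 = 0 by apply: (addrI (iota 0)); rewrite -iD !addr0.
elim=> {s t} //=.
- by move=> s t r _ -> _ ->.
- by move=> s s' t t' _ -> _ ->.
- by move=> s s' t t' _ -> _ ->.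
- by move=> s t r; rewrite addrA.
- by move=> s t; rewrite addrC.
- by move=> t; rewrite i0 add0r.
- by move=> s t r; rewrite mulrA.
- by move=> t; rewrite i1 mul1r.
- by move=> t; rewrite i0 mul0r.
- by move=> s t r; rewrite mulrDl.
- by move=> s t r; rewrite mulrDr.
Qed.

Lemma palg_liftE t : palg_lift (api t) = aeval t.
Proof. exact/aeval_aeq/aeq_repr. Qed.

Lemma palg_lift_gen x : palg_lift (palg_gen x) = f x.
Proof. exact: palg_liftE. Qed.

Lemma palg_liftC c : palg_lift (c *: (1 : palg)) = iota c.
Proof. by rewrite -palg_piC palg_liftE. Qed.

Lemma palg_liftD s t : palg_lift (s + t) = palg_lift s + palg_lift t.
Proof.
by rewrite -(palg_repr s) -(palg_repr t) -palg_piD !palg_liftE.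
Qed.

Lemma palg_liftM s t : palg_lift (s * t) = palg_lift s * palg_lift t.
Proof.
by rewrite -(palg_repr s) -(palg_repr t) -palg_piM !palg_liftE.
Qed.

Lemma palg_lift1 : palg_lift 1 = 1.
Proof. by have [<- _ _ _] := iotaP; rewrite -palg_liftC scale1r. Qed.

Lemma palg_liftZ c t : palg_lift (c *: t) = iota c * palg_lift t.
Proof. by rewrite -{1}(mul1r t) palg_scaleAl palg_liftM palg_liftC. Qed.

End Lift.

End PresentedAlgebra.

HB.mixin Record Algebra_isHopf (F : fieldType) H of GRing.Algebra F H := {
  comul : H -> tensor H H;
  counit : H -> F;
  antipode : H -> H;
  comul_linear : linear comul;
  comul_monoid_morphism : monoid_morphism comul;
  counit_linear : scalar counit;
  counit_monoid_morphism : monoid_morphism counit;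
  antipode_linear : linear antipode;
  comulA : forall h : H,
    tlift (fun h1 h2 => tlift (fun h11 h12 => h11 \ox (h12 \ox h2)) (comul h1))
      (comul h)
    = tlift (fun h1 h2 => h1 \ox comul h2) (comul h);
  counitl : forall h : H, tlift (fun h1 h2 => counit h1 *: h2) (comul h) = h;
  counitr : forall h : H, tlift (fun h1 h2 => counit h2 *: h1) (comul h) = h;
  antipodel : forall h : H,
    tlift (fun h1 h2 => antipode h1 * h2) (comul h) = (counit h)%:A;
  antipoder : forall h : H,
    tlift (fun h1 h2 => h1 * antipode h2) (comul h) = (counit h)%:A
}.

#[short(type="hopfAlgType")]
HB.structure Definition HopfAlgebra (F : fieldType) :=
  { H of GRing.Algebra F H & Algebra_isHopf F H }.

Section Actions.
Variables (F : fieldType) (H : hopfAlgType F) (A : algType F).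

Definition convolution (u v : H -> A) (h : H) : A :=
  tlift (fun h1 h2 => u h1 * v h2) (comul h).

Definition convolution_inverse (u v : H -> A) : Prop :=
  forall h, convolution u v h = (counit h)%:A
         /\ convolution v u h = (counit h)%:A.

Record module_algebra (act : H -> A -> A) : Prop := ModuleAlgebra {
  act_linearl : forall a, linear (act^~ a);
  act_linearr : forall h, linear (act h);
  act_1 : forall a, act 1 a = a;
  act_M : forall h k a, act (h * k) a = act h (act k a);
  act_unit : forall h, act h 1 = (counit h)%:A;
  act_mul : forall h a b,
    act h (a * b) = tlift (fun h1 h2 => act h1 a * act h2 b) (comul h)
}.

Definition inner_via (u : {linear H -> A}) (act : H -> A -> A) : Prop :=
  u 1 = 1 /\
  exists v : {linear H -> A}, convolution_inverse u v /\
    forall h a, act h a = tlift (fun h1 h2 => u h1 * a * v h2) (comul h).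

End Actions.

Section Characters.
Variables (F : fieldType) (gT : finGroupType).

(* Values in F suffice: they are automatically nonzero, see [char_neq0]. *)
Definition is_character (chi : {ffun gT -> F}) : bool :=
  (chi 1%g == 1) && [forall g, forall h, chi (g * h)%g == chi g * chi h].

Record character := Character {
  char_val :> {ffun gT -> F};
  _ : is_character char_val
}.

HB.instance Definition _ := [isSub for char_val].
HB.instance Definition _ := [Choice of character by <:].

Lemma char1 (chi : character) : chi 1%g = 1.
Proof. by case: chi => /= chi /andP[/eqP]. Qed.

Lemma charM (chi : character) g h : chi (g * h)%g = chi g * chi h.
Proof. by case: chi => /= chi /andP[_ /forallP/(_ g)/forallP/(_ h)/eqP]. Qed.

Lemma charX (chi : character) g k : chi (g ^+ k)%g = chi g ^+ k.
Proof. by elim: k => [|k IHk]; rewrite ?char1 // expgS exprS charM IHk. Qed.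

Lemma char_order (chi : character) g : chi g ^+ #|[set: gT]| = 1.
Proof. by rewrite -charX expg_cardG ?inE // char1. Qed.

Lemma char_neq0 (chi : character) g : chi g != 0.
Proof.
apply/eqP => chi0; have := char1 chi; rewrite -(mulgV g) charM chi0 mul0r.
by move/esym/eqP; rewrite oner_eq0.
Qed.

End Characters.

Record qls (F : fieldType) (gT : finGroupType) (n : nat) := QLS {
  qls_a : 'I_n -> gT;
  qls_chi : 'I_n -> character F gT;
  qls_abelian : abelian [set: gT];
  qls_neq1 : forall i, qls_chi i (qls_a i) != 1;
  qls_braiding : forall i j, i != j ->
    qls_chi j (qls_a i) * qls_chi i (qls_a j) = 1
}.

Section QuantumLinearSpace.
Variables (F : fieldType) (gT : finGroupType) (n : nat) (R : qls F gT n).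

Definition qls_q (i : 'I_n) : F := qls_chi R i (qls_a R i).

(* The multiplicative order of q_i, see [qls_N_prim]. *)
Definition qls_N (i : 'I_n) : nat :=
  s2val (prim_order_exists (cardG_gt0 [set: gT])
           (char_order (qls_chi R i) (qls_a R i))).

Lemma qls_N_prim i : (qls_N i).-primitive_root (qls_q i).
Proof. by rewrite /qls_N; case: prim_order_exists. Qed.

Record compatible_datum := CompatibleDatum {
  cd_mu : 'I_n -> bool;
  cd_lambda : 'I_n -> 'I_n -> F; (* only the entries with i < j are used *)
  cd_muP : forall i,
    (qls_a R i ^+ qls_N i)%g = 1%g
      \/ ~ (forall g, qls_chi R i g ^+ qls_N i = 1) ->
    cd_mu i = false;
  cd_lambdaP : forall i j : 'I_n, (i < j)%N ->
    (qls_a R i * qls_a R j)%g = 1%g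
      \/ ~ (forall g, qls_chi R i g * qls_chi R j g = 1) ->
    cd_lambda i j = 0
}.

End QuantumLinearSpace.

Section LiftingPresentation.
Variables (F : fieldType) (gT : finGroupType) (n : nat).
Variables (R : qls F gT n) (D : compatible_datum R).

Local Notation a := (qls_a R).
Local Notation chi := (qls_chi R).
Local Notation N := (qls_N R).
Local Notation term := (aterm F (gT + 'I_n)).
Local Notation G g := (AVar (inl g%g) : term).
Local Notation X i := (AVar (inr i) : term).

Definition aexp (t : term) (k : nat) : term := iter k (AMul t) (AConst 1).

Inductive lifting_rel : term -> term -> Prop :=
| rel_group1 : lifting_rel (G 1) (AConst 1)
| rel_groupM g h : lifting_rel (G g * G h) (G (g * h))
| rel_gx g i : lifting_rel (G g * X i) (AConst (chi i g) * (X i * G g))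
| rel_power i :
    lifting_rel (aexp (X i) (N i))
      (AConst (cd_mu D i)%:R * (AConst 1 + AConst (-1) * G (a i ^+ N i)))
| rel_link (i j : 'I_n) : (i < j)%N ->
    lifting_rel (X j * X i)
      (AConst (chi i (a j)) * (X i * X j)
       + AConst (cd_lambda D i j) * (AConst 1 + AConst (-1) * G (a i * a j))).

Definition lifting : Type := palg lifting_rel.

End LiftingPresentation.

Lemma prim_root_sign (F : fieldType) (N : nat) (q : F) :
  N.-primitive_root q -> (-1) ^+ N * q ^+ (\sum_(0 <= i < N) i) = -1.
Proof.
move=> qN; have N_gt0 := prim_order_gt0 qN.
have := congr1 (fun p => p.[0]) (factor_Xn_sub_1 qN).
rewrite horner_prod hornerD hornerN hornerXn hornerC expr0n.
rewrite -[N == 0%N]negbK -lt0n N_gt0 /= add0r => e; rewrite -[RHS]e {e}.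
rewrite !big_mkord.
under [RHS]eq_bigr => i _ do rewrite hornerXsubC sub0r -mulN1r.
by rewrite big_split /= prodr_const card_ord prodrXr.
Qed.

(* Gaussian binomial coefficients.  They vanish for 0 < k < N when q is a
   primitive N-th root of unity, so (x + y)^N = x^N + y^N if y x = q x y; this
   makes the comultiplication below compatible with the relations x_i^N_i. *)
Section QBinomial.
Variables (F : fieldType) (q : F).

Fixpoint qbin (n k : nat) : F :=
  match n, k with
  | _, 0 => 1
  | 0, _.+1 => 0
  | n'.+1, k'.+1 => qbin n' k' + q ^+ k * qbin n' k
  end.

Definition qint (n : nat) : F := \sum_(0 <= i < n) q ^+ i.
Definition qfact (n : nat) : F := \prod_(0 <= i < n) qint i.+1.

Lemma qbin0 n : qbin n 0 = 1. Proof. by case: n. Qed.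

Lemma qbin_gt n k : (n < k)%N -> qbin n k = 0.
Proof.
elim: n k => [|n IHn] [|k] //= nk.
by rewrite !IHn ?mulr0 ?addr0 // ltnW.
Qed.

Lemma qbinn n : qbin n n = 1.
Proof. by elim: n => //= n ->; rewrite qbin_gt // mulr0 addr0. Qed.

Lemma qintD k m : qint (k + m) = qint k + q ^+ k * qint m.
Proof.
have qintS n : qint n.+1 = qint n + q ^+ n by rewrite /qint big_nat_recr.
elim: m => [|m IHm]; first by rewrite addn0 [qint 0]/qint big_geq // mulr0 addr0.
by rewrite addnS !qintS IHm exprD mulrDr addrA.
Qed.

Lemma qfactS n : qfact n.+1 = qfact n * qint n.+1.
Proof. by rewrite /qfact big_nat_recr. Qed.

Lemma qbin_fact k m : qbin (k + m) k * (qfact k * qfact m) = qfact (k + m).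
Proof.
have qfact0 : qfact 0 = 1 by rewrite /qfact big_geq.
have [n] := ubnP (k + m)%N; elim: n k m => // n IHn [|k] [|m] ltn.
- by rewrite qbin0 qfact0 !mulr1.
- by rewrite qbin0 qfact0 !mul1r.
- by rewrite addn0 qbinn qfact0 mulr1 mul1r.
- have e1 := IHn k m.+1 ltn.
  have e2 : qbin (k + m.+1) k.+1 * (qfact k.+1 * qfact m) = qfact (k + m.+1).
    by rewrite -addSnnS; apply: IHn; rewrite addSnnS.
  have -> : qfact (k.+1 + m.+1) = qfact (k + m.+1) * qint (k.+1 + m.+1).
    by rewrite addSn qfactS.
  rewrite qintD mulrDr -{1}e1 -e2 addSn /= !(qfactS k) !(qfactS m).
  by ring.
Qed.

End QBinomial.

Lemma qbin_prim_root (F : fieldType) (q : F) (N k : nat) :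
  N.-primitive_root q -> (0 < k < N)%N -> qbin q N k = 0.
Proof.
move=> qN /andP[k0 kN]; have N1 : (1 < N)%N by apply: leq_ltn_trans kN.
have qint_neq0 j : (0 < j < N)%N -> qint q j != 0.
  move=> /andP[j0 jN]; apply/eqP => qj0.
  have : q ^+ j == 1.
    by rewrite -subr_eq0 subrX1 -(big_mkord xpredT (fun i => q ^+ i)) -/(qint q j) qj0 mulr0.
  by rewrite -(prim_order_dvd qN) gtnNdvd.
have qfact_neq0 j : (j < N)%N -> qfact q j != 0.
  elim: j => [|j IHj] jN; first by rewrite /qfact big_geq ?oner_neq0.
  by rewrite qfactS mulf_neq0 ?IHj ?qint_neq0 // ltnW.
have qN0 : qint q N = 0.
  have : (q - 1) * qint q N = 0.
    by rewrite /qint big_mkord -subrX1 (prim_expr_order qN) subrr.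
  move/eqP; rewrite mulf_eq0 subr_eq0 => /orP[/eqP q1|/eqP//].
  by have := prim_order_dvd qN 1; rewrite q1 expr1n eqxx dvdn1 => /eqP; case: N N1 {qN kN qint_neq0 qfact_neq0} => [|[]].
have := qbin_fact q k (N - k); rewrite subnKC 1?ltnW //.
have -> : qfact q N = 0 by case: N N1 qN0 {qN kN qint_neq0 qfact_neq0} => // N _ qN0; rewrite qfactS qN0 mulr0.
move/eqP; rewrite mulf_eq0 => /orP[/eqP//|].
rewrite mulf_eq0 (negPf (qfact_neq0 _ kN)) (negPf (qfact_neq0 _ _)) //.
by rewrite ltn_subrL k0 ltnW.
Qed.

Section QBinomialTheorem.
Variables (F : fieldType) (T : pzRingType) (iota : F -> T).
Hypothesis iotaP : central_morphism iota.
Variables (q : F) (x y : T).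
Hypothesis xy : y * x = iota q * (x * y).

Let i1 : iota 1 = 1. Proof. by case: iotaP. Qed.
Let iD c d : iota (c + d) = iota c + iota d. Proof. by case: iotaP. Qed.
Let iM c d : iota (c * d) = iota c * iota d. Proof. by case: iotaP. Qed.
Let iC c t : iota c * t = t * iota c. Proof. by case: iotaP. Qed.
Let i0 : iota 0 = 0.
Proof. by apply: (addrI (iota 0)); rewrite -iD !addr0. Qed.

Lemma qcommX k : y * x ^+ k = iota (q ^+ k) * (x ^+ k * y).
Proof.
elim: k => [|k IHk]; first by rewrite i1 !mul1r mulr1.
rewrite exprS mulrA xy -!mulrA IHk exprS iM -!mulrA.
by congr (_ * _); rewrite !mulrA iC.
Qed.

Lemma qbinomial n :
  (x + y) ^+ n = \sum_(0 <= k < n.+1) iota (qbin q n k) * (x ^+ k * y ^+ (n - k)).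
Proof.
elim: n => [|n IHn]; first by rewrite big_nat1 i1 !mul1r.
rewrite exprS {}IHn mulrDl !mulr_sumr [RHS]big_nat_recl // /=.
have -> : \sum_(0 <= k < n.+1) y * (iota (qbin q n k) * (x ^+ k * y ^+ (n - k)))
   = \sum_(0 <= k < n.+2) iota (q ^+ k * qbin q n k) * (x ^+ k * y ^+ (n.+1 - k)).
  rewrite [RHS]big_nat_recr //= qbin_gt // mulr0 i0 mul0r addr0.
  apply: eq_big_nat => k /andP[_ kn].
  rewrite mulrA -iC -mulrA [y * _]mulrA qcommX subSn // exprS.
  by rewrite [q ^+ k * _]mulrC iM !mulrA.
rewrite [X in _ + X]big_nat_recl // addrCA qbin0 !mul1r; congr (_ + _).
rewrite -big_split; apply: eq_bigr => k _ /=.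
rewrite subSS iD mulrDl; congr (_ + _).
by rewrite mulrA -iC exprS !mulrA.
Qed.

Lemma qbinomial_prim N : N.-primitive_root q ->
  (x + y) ^+ N = x ^+ N + y ^+ N.
Proof.
move=> qN; rewrite qbinomial; have N0 := prim_order_gt0 qN.
rewrite big_nat_recr // big_ltn //= subnn qbin0 qbinn i1 !mul1r !mulr1 subn0.
rewrite big_nat_cond big1 ?addr0 1?addrC // => k /andP[kN _].
by rewrite (qbin_prim_root qN) // i0 mul0r.
Qed.

End QBinomialTheorem.

Section LiftingHopf.
Variables (F : fieldType) (gT : finGroupType) (n : nat).
Variables (R : qls F gT n) (D : compatible_datum R).

Local Notation a := (qls_a R).
Local Notation chi := (qls_chi R).
Local Notation N := (qls_N R).
Local Notation q := (qls_q R).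
Local Notation mu := (cd_mu D).
Local Notation lambda := (cd_lambda D).
Local Notation H := (lifting D).

HB.instance Definition _ := GRing.Lmodule.copy H (palg (lifting_rel D)).
HB.instance Definition _ := GRing.PzRing.copy H (palg (lifting_rel D)).

Definition lifting_g (g : gT) : H := palg_gen (lifting_rel D) (inl g).
Definition lifting_x (i : 'I_n) : H := palg_gen (lifting_rel D) (inr i).
Local Notation g_ := lifting_g.
Local Notation x_ := lifting_x.

Let rel s t : lifting_rel D s t ->
  palg_pi (lifting_rel D) s = palg_pi (lifting_rel D) t.
Proof. by move=> st; apply/palg_piP/aeq_rel. Qed.

Let piE := (@palg_piD F _ (lifting_rel D), @palg_piM F _ (lifting_rel D),
            @palg_piC F _ (lifting_rel D)).

Lemma lifting_scaleAl c (s t : H) : c *: (s * t) = c *: s * t.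
Proof. exact: palg_scaleAl. Qed.
Lemma lifting_scaleAr c (s t : H) : c *: (s * t) = s * (c *: t).
Proof. exact: palg_scaleAr. Qed.

Lemma palg_pi_aexp t k :
  palg_pi (lifting_rel D) (aexp t k) = palg_pi (lifting_rel D) t ^+ k.
Proof.
by elim: k => [|k IHk]; rewrite ?exprS -?IHk ?piE // scale1r.
Qed.

Lemma aeval_aexp (T : pzRingType) (iota : F -> T) (f : gT + 'I_n -> T) t k :
  iota 1 = 1 -> aeval iota f (aexp t k) = aeval iota f t ^+ k.
Proof. by move=> i1; elim: k => [|k IHk] //=; rewrite exprS -IHk. Qed.

Lemma lifting_g1 : g_ 1 = 1.
Proof. by rewrite [LHS](rel (rel_group1 D)) piE scale1r. Qed.

Lemma lifting_gM g h : g_ (g * h)%g = g_ g * g_ h.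
Proof. by rewrite [LHS](esym (rel (rel_groupM D g h))) piE. Qed.

Lemma lifting_gx g i : g_ g * x_ i = chi i g *: (x_ i * g_ g).
Proof.
have := rel (rel_gx D g i).
by rewrite !piE -palg_scaleAl mul1r.
Qed.

Lemma lifting_power i :
  x_ i ^+ N i = (mu i)%:R *: (1 - g_ (a i ^+ N i)%g).
Proof.
have := rel (rel_power D i).
by rewrite palg_pi_aexp !piE -!palg_scaleAl !mul1r scale1r scaleN1r.
Qed.

Lemma lifting_link (i j : 'I_n) : (i < j)%N ->
  x_ j * x_ i
  = chi i (a j) *: (x_ i * x_ j) + lambda i j *: (1 - g_ (a i * a j)%g).
Proof.
move=> ij; have := rel (rel_link D ij).
by rewrite !piE -!palg_scaleAl !mul1r scale1r scaleN1r.
Qed.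

Lemma lifting_gV g : g_ g^-1%g * g_ g = 1.
Proof. by rewrite -lifting_gM mulVg lifting_g1. Qed.

Lemma lifting_gVr g : g_ g * g_ g^-1%g = 1.
Proof. by rewrite -lifting_gM mulgV lifting_g1. Qed.

Lemma lifting_gC g h : g_ g * g_ h = g_ h * g_ g.
Proof.
rewrite -!lifting_gM; congr g_.
by apply: (centsP (qls_abelian R)); rewrite inE.
Qed.

Lemma lifting_gX g k : g_ (g ^+ k)%g = g_ g ^+ k.
Proof.
elim: k => [|k IHk]; first by rewrite expg0 lifting_g1.
by rewrite expgS exprS lifting_gM IHk.
Qed.

Lemma lifting_ind (P : H -> Prop) :
    (forall g, P (g_ g)) -> (forall i, P (x_ i)) -> (forall c, P (c *: (1 : H))) ->
    (forall s t, P s -> P t -> P (s + t)) ->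
    (forall s t, P s -> P t -> P (s * t)) ->
  forall t, P t.
Proof.
move=> Pg Px Pc PD PM t.
by apply: (palg_ind (P := P)) t => // -[].
Qed.

Definition lifting_counit : H -> F :=
  palg_lift (R := lifting_rel D) id
    (fun v => match v with inl _ => 1 | inr _ => 0 end).
Local Notation eps := lifting_counit.

Lemma counit_central : central_morphism (id : F -> F).
Proof. by split=> // c t; rewrite mulrC. Qed.

Lemma counit_rel s t : lifting_rel D s t ->
  aeval id (fun v : gT + 'I_n => match v with inl _ => 1 | inr _ => 0 end) s
  = aeval id (fun v => match v with inl _ => 1 | inr _ => 0 end) t.
Proof.
case=> {s t} [|g h|g i|i|i j ij] //=.
- by rewrite mulr1.
- by rewrite !(mulr0, mul0r).
- rewrite aeval_aexp //= mulr1 subrr mulr0 expr0n.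
  by rewrite eqn0Ngt (prim_order_gt0 (qls_N_prim R i)).
- by rewrite !(mulr0, mul0r) mulr1 subrr mulr0 addr0.
Qed.

Let epsD s t : eps (s + t) = eps s + eps t.
Proof. exact: (palg_liftD counit_central counit_rel). Qed.
Let epsM s t : eps (s * t) = eps s * eps t.
Proof. exact: (palg_liftM counit_central counit_rel). Qed.
Let eps1 : eps 1 = 1.
Proof. exact: (palg_lift1 counit_central counit_rel). Qed.
Let epsZ c t : eps (c *: t) = c * eps t.
Proof. exact: (palg_liftZ counit_central counit_rel). Qed.
Let eps_g g : eps (g_ g) = 1.
Proof. exact: (palg_lift_gen counit_central counit_rel). Qed.
Let eps_x i : eps (x_ i) = 0.
Proof. exact: (palg_lift_gen counit_central counit_rel). Qed.

Lemma lifting_oner_neq0 : 1 != 0 :> H.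
Proof.
apply/eqP => H10; have := eps1; rewrite H10 -(scale0r (1 : H)) epsZ mul0r.
by move/esym/eqP; rewrite oner_eq0.
Qed.

HB.instance Definition _ :=
  GRing.PzSemiRing_isNonZero.Build H lifting_oner_neq0.
HB.instance Definition _ := GRing.Lmodule_isLalgebra.Build F H lifting_scaleAl.
HB.instance Definition _ := GRing.Lalgebra_isAlgebra.Build F H lifting_scaleAr.

Definition comul_gen (v : gT + 'I_n) : tensor H H :=
  match v with
  | inl g => g_ g \ox g_ g
  | inr i => x_ i \ox 1 + g_ (a i) \ox x_ i
  end.

Definition lifting_comul : H -> tensor H H :=
  palg_lift (R := lifting_rel D) (fun c => c *: (1 : tensor H H)) comul_gen.
Local Notation Delta := lifting_comul.
Local Notation iota := (fun c : F => c *: (1 : tensor H H)).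

Lemma comul_central : central_morphism iota.
Proof.
split=> [|c d|c d|c t].
- by rewrite scale1r.
- by rewrite scalerDl.
- by rewrite -tensorAl mul1r scalerA.
- by rewrite -tensorAl -tensorAr mul1r mulr1.
Qed.

Let iotaE c (t : tensor H H) : iota c * t = c *: t.
Proof. by rewrite /= -tensorAl mul1r. Qed.

Lemma comul_rel s t : lifting_rel D s t ->
  aeval iota comul_gen s = aeval iota comul_gen t.
Proof.
case=> {s t} [|g h|g i|i|i j ij] /=.
- by rewrite lifting_g1 scale1r.
- by rewrite tensorM lifting_gM.
- rewrite iotaE mulrDr mulrDl !tensorM scalerDr lifting_gx mulr1 mul1r.
  by rewrite tpureZl tpureZr lifting_gC.
- rewrite aeval_aexp ?scale1r //= !iotaE scaleN1r.
  have qc : g_ (a i) \ox x_ i * (x_ i \ox 1)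
          = iota (q i) * (x_ i \ox 1 * (g_ (a i) \ox x_ i)).
    by rewrite iotaE !tensorM mulr1 mul1r lifting_gx tpureZl.
  rewrite (qbinomial_prim comul_central qc (qls_N_prim R i)).
  rewrite !tensorX expr1n lifting_power -lifting_gX tpureZl tpureZr -scalerDr.
  by congr (_ *: _); rewrite tpureDl tpureDr tpureNl tpureNr addrA addrNK.
- have xg : x_ j * g_ (a i) = chi i (a j) *: (g_ (a i) * x_ j).
    have ji : i != j by apply: contraTneq ij => ->; rewrite ltnn.
    by rewrite lifting_gx scalerA mulrC (qls_braiding R ji) scale1r.
  rewrite !iotaE scaleN1r !(mulrDl, mulrDr) !tensorM !mulr1 !mul1r xg.
  rewrite (lifting_gx (a j) i) (lifting_gC (a j)) -lifting_gM.
  rewrite (lifting_link ij) !(tpureDl, tpureDr, tpureZl, tpureZr).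
  rewrite !scaleN1r scale1r.
  set A := g_ (_ * _)%g.
  have -> : 1 - A \ox A = (1 \ox 1 - A \ox 1) + (A \ox 1 - A \ox A) :> tensor H H.
    by rewrite addrA addrNK.
  by rewrite !scalerDr !addrA [LHS](ACl (1*5*4*6*2*3*7*8)).
Qed.

Let DeltaD s t : Delta (s + t) = Delta s + Delta t.
Proof. exact: (palg_liftD comul_central comul_rel). Qed.
Let DeltaM s t : Delta (s * t) = Delta s * Delta t.
Proof. exact: (palg_liftM comul_central comul_rel). Qed.
Let Delta1 : Delta 1 = 1.
Proof. exact: (palg_lift1 comul_central comul_rel). Qed.
Let DeltaZ c t : Delta (c *: t) = c *: Delta t.
Proof. by rewrite [LHS](palg_liftZ comul_central comul_rel) iotaE. Qed.
Let Delta_g g : Delta (g_ g) = g_ g \ox g_ g.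
Proof. exact: (palg_lift_gen comul_central comul_rel). Qed.
Let Delta_x i : Delta (x_ i) = x_ i \ox 1 + g_ (a i) \ox x_ i.
Proof. exact: (palg_lift_gen comul_central comul_rel). Qed.

Lemma lifting_counit_linear : scalar (eps : H -> F).
Proof. by move=> c s t; rewrite epsD epsZ. Qed.
Lemma lifting_counit_monoid_morphism : monoid_morphism (eps : H -> F).
Proof. by split=> [|s t]; rewrite ?eps1 ?epsM. Qed.
Lemma lifting_comul_linear : linear (Delta : H -> tensor H H).
Proof. by move=> c s t; rewrite DeltaD DeltaZ. Qed.
Lemma lifting_comul_monoid_morphism :
  monoid_morphism (Delta : H -> tensor H H).
Proof. by split=> [|s t]; rewrite ?Delta1 ?DeltaM. Qed.

Let counitl_bilin : bilinear_map (fun h1 h2 : H => eps h1 *: h2).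
Proof.
split=> [b|s] c x y /=; first by rewrite epsD epsZ scalerDl scalerA.
by rewrite scalerDr !scalerA mulrC.
Qed.

Let counitr_bilin : bilinear_map (fun h1 h2 : H => eps h2 *: h1).
Proof.
split=> [b|s] c x y /=; first by rewrite scalerDr !scalerA mulrC.
by rewrite epsD epsZ scalerDl scalerA.
Qed.

Lemma lifting_counitl (h : H) : tlift (fun h1 h2 => eps h1 *: h2) (Delta h) = h.
Proof.
elim/lifting_ind: h => [g|i|c|s t IHs IHt|s t IHs IHt].
- by rewrite Delta_g tlift_tpure // eps_g scale1r.
- by rewrite Delta_x tliftD // !tlift_tpure // eps_x eps_g scale0r add0r scale1r.
- by rewrite DeltaZ Delta1 tliftZ // tlift_tpure // eps1 scale1r.
- by rewrite DeltaD tliftD // IHs IHt.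
- rewrite DeltaM (tlift_tmul (mul_bilin _) counitl_bilin counitl_bilin) //.
    by rewrite IHs IHt.
  by move=> b b' c c'; rewrite epsM -scalerAl -scalerAr scalerA.
Qed.

Lemma lifting_counitr (h : H) : tlift (fun h1 h2 => eps h2 *: h1) (Delta h) = h.
Proof.
elim/lifting_ind: h => [g|i|c|s t IHs IHt|s t IHs IHt].
- by rewrite Delta_g tlift_tpure // eps_g scale1r.
- by rewrite Delta_x tliftD // !tlift_tpure // eps_x eps1 scale0r addr0 scale1r.
- by rewrite DeltaZ Delta1 tliftZ // tlift_tpure // eps1 scale1r.
- by rewrite DeltaD tliftD // IHs IHt.
- rewrite DeltaM (tlift_tmul (mul_bilin _) counitr_bilin counitr_bilin) //.
    by rewrite IHs IHt.
  by move=> b b' c c'; rewrite epsM -scalerAl -scalerAr scalerA.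
Qed.

Let tensor_mul_bilin : bilinear_map (@GRing.mul (tensor H H)).
Proof.
split=> [t|t] c x y /=; first by rewrite mulrDl tensorAl.
by rewrite mulrDr tensorAr.
Qed.

Local Notation mul3 := (@tmul F H (tensor H H) *%R *%R).

Let mul3_bilin : bilinear_map mul3.
Proof. by apply: tmul_bilin; first apply: mul_bilin. Qed.

Let mul3E (b b' : H) (t t' : tensor H H) :
  mul3 (b \ox t) (b' \ox t') = (b * b') \ox (t * t').
Proof. by apply: tmulE; first apply: mul_bilin. Qed.

Let assoc_in (h2 h11 h12 : H) := h11 \ox (h12 \ox h2).

Let assoc_in_bilin h2 : bilinear_map (assoc_in h2).
Proof.
split=> [t|t] c x y; rewrite /assoc_in /=; first by rewrite tpureDl tpureZl.
by rewrite tpureDl tpureZl tpureDr tpureZr.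
Qed.

Let assoc_l (h1 h2 : H) := tlift (assoc_in h2) (Delta h1).
Let assoc_r (h1 h2 : H) := h1 \ox Delta h2.

Let assoc_l_bilin : bilinear_map assoc_l.
Proof.
split=> [t|t] c x y; rewrite /assoc_l /=.
  by rewrite DeltaD DeltaZ tliftD // tliftZ.
apply: tlift_fun_linear => b b'.
by rewrite /assoc_in !(tpureDr, tpureZr).
Qed.

Let assoc_r_bilin : bilinear_map assoc_r.
Proof.
split=> [t|t] c x y; rewrite /assoc_r /=; first by rewrite tpureDl tpureZl.
by rewrite DeltaD DeltaZ tpureDr tpureZr.
Qed.

Lemma lifting_comulA (h : H) :
  tlift (fun h1 h2 => tlift (fun h11 h12 => h11 \ox (h12 \ox h2)) (Delta h1))
    (Delta h)
  = tlift (fun h1 h2 => h1 \ox Delta h2) (Delta h).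
Proof.
rewrite -[LHS]/(tlift assoc_l (Delta h)) -[RHS]/(tlift assoc_r (Delta h)).
elim/lifting_ind: h => [g|i|c|s t IHs IHt|s t IHs IHt].
- by rewrite Delta_g !tlift_tpure // /assoc_l /assoc_r Delta_g tlift_tpure.
- rewrite Delta_x !tliftD // !tlift_tpure // /assoc_l /assoc_r Delta_g Delta_x.
  by rewrite tliftD // !tlift_tpure // Delta1 tpureDr addrA.
- rewrite DeltaZ !tliftZ // Delta1 !tlift_tpure // /assoc_l /assoc_r.
  by rewrite Delta1 tlift_tpure.
- by rewrite DeltaD !tliftD // IHs IHt.
- rewrite DeltaM (tlift_tmul mul3_bilin assoc_l_bilin assoc_l_bilin) //.
    rewrite (tlift_tmul mul3_bilin assoc_r_bilin assoc_r_bilin) //.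
      by rewrite IHs IHt.
    by move=> b b' c c'; rewrite /assoc_r DeltaM mul3E.
  move=> b b' c c'; rewrite /assoc_l DeltaM.
  apply: (tlift_tmul mul3_bilin) => // d d' e e'.
  by rewrite /assoc_in mul3E tensorM.
Qed.

Definition antipode_gen (v : gT + 'I_n) : H :=
  match v with
  | inl g => g_ g^-1%g
  | inr i => - (g_ (a i)^-1%g * x_ i)
  end.

Definition lifting_antipode (h : H) : H :=
  palg_lift (R := lifting_rel D) (T := H^c) (fun c => c *: (1 : H)) antipode_gen h.
Local Notation S := lifting_antipode.
Local Notation iotac := (fun c : F => c *: (1 : H) : H^c).

Lemma antipode_central : central_morphism iotac.
Proof.
split=> [|c d|c d|c t].
- by rewrite scale1r.
- by rewrite scalerDl.
- by rewrite [RHS]/GRing.mul /= -scalerAl mul1r scalerA mulrC.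
- by rewrite /GRing.mul /= -scalerAr -scalerAl mul1r mulr1.
Qed.

Let xgV i g : x_ i * g_ g^-1%g = chi i g *: (g_ g^-1%g * x_ i).
Proof.
rewrite -[LHS]mul1r -(lifting_gV g) mulrA -(mulrA _ _ (x_ i)) lifting_gx.
by rewrite -scalerAr -scalerAl -!mulrA lifting_gVr mulr1.
Qed.

Let mulcE (s t : H) : @GRing.mul H^c s t = @GRing.mul H t s.
Proof. by []. Qed.

Let expcE (s : H) k : @GRing.exp H^c s k = @GRing.exp H s k.
Proof. by elim: k => // k IHk; rewrite exprS mulcE IHk exprSr. Qed.

Let gVx_expr i k :
  (g_ (a i)^-1%g * x_ i) ^+ k
  = q i ^+ (\sum_(0 <= m < k) m) *: (g_ (a i)^-1%g ^+ k * x_ i ^+ k).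
Proof.
have xk m : x_ i ^+ m * g_ (a i)^-1%g = q i ^+ m *: (g_ (a i)^-1%g * x_ i ^+ m).
  elim: m => [|m IHm]; first by rewrite mul1r mulr1 scale1r.
  rewrite [x_ i ^+ m.+1 in LHS]exprSr -mulrA xgV -scalerAr [X in _ *: X = _]mulrA.
  by rewrite IHm -scalerAl scalerA -exprS -mulrA -exprSr.
elim: k => [|k IHk]; first by rewrite big_geq // mul1r scale1r.
rewrite exprSr IHk big_nat_recr //= exprD -scalerAl -mulrA (mulrA (x_ i ^+ k)) xk.
by rewrite -scalerAl -scalerAr scalerA !mulrA -exprSr -mulrA -exprSr.
Qed.

Lemma antipode_rel s t : lifting_rel D s t ->
  aeval iotac antipode_gen s = aeval iotac antipode_gen t.
Proof.
case=> {s t} [|g h|g i|i|i j ij] /=; rewrite ?mulcE.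
- by rewrite invg1 lifting_g1 scale1r.
- by rewrite invMg lifting_gM.
- rewrite mulr_algr mulNr -mulrA xgV -scalerAr mulrA.
  by rewrite lifting_gC -mulrA mulrN scalerN.
- rewrite aeval_aexp ?scale1r //= expcE exprNn gVx_expr lifting_power !mulr_algr.
  have -> : (-1 : H) ^+ N i = ((-1) ^+ N i)%:A.
    by rewrite -[-1 in LHS]scaleN1r exprZn expr1n.
  rewrite mulr_algl scalerA (prim_root_sign (qls_N_prim R i)) -lifting_gX expgVn.
  rewrite -scalerAr scalerA mulrC -scalerA; congr (_ *: _).
  by rewrite !scaleN1r mulrBr mulr1 -lifting_gM mulVg lifting_g1 opprB.
- have ji : i != j by apply: contraTneq ij => ->; rewrite ltnn.
  set B := g_ (_ * _)^-1%g.
  have BE : B = g_ (a i)^-1%g * g_ (a j)^-1%g.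
    by rewrite /B invMg lifting_gM lifting_gC.
  rewrite !mulrNN !mulr_algr -!mulrA (mulrA (x_ i)) (mulrA (x_ j)) !xgV.
  rewrite -!scalerAl -!scalerAr scalerA mulrC (qls_braiding R ji) scale1r.
  rewrite !mulrA (lifting_gC (a j)^-1%g) -BE -!mulrA (lifting_link ij).
  rewrite mulrDr -!scalerAr mulrBr mulr1 -lifting_gM mulVg lifting_g1.
  by rewrite -addrA -scalerDr scaleN1r scale1r addrA addrNK addrN scaler0 addr0.
Qed.

Let S_lin : linear S.
Proof.
move=> c s t; rewrite /S (palg_liftD antipode_central antipode_rel).
rewrite (palg_liftZ antipode_central antipode_rel) mulcE.
by rewrite -scalerAr mulr1.
Qed.
Let SD s t : S (s + t) = S s + S t.
Proof. exact: (palg_liftD antipode_central antipode_rel). Qed.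
Let SM s t : S (s * t) = S t * S s.
Proof. exact: (palg_liftM antipode_central antipode_rel). Qed.
Let S1 : S 1 = 1.
Proof. exact: (palg_lift1 antipode_central antipode_rel). Qed.
Let SZ c t : S (c *: t) = c *: S t.
Proof.
have S0 : S 0 = 0.
  by have := S_lin (-1) 0 0; rewrite scaler0 addr0 scaleN1r addNr.
by have := S_lin c t 0; rewrite !addr0 S0 addr0.
Qed.
Let S_g g : S (g_ g) = g_ g^-1%g.
Proof. exact: (palg_lift_gen antipode_central antipode_rel). Qed.
Let S_x i : S (x_ i) = - (g_ (a i)^-1%g * x_ i).
Proof. exact: (palg_lift_gen antipode_central antipode_rel). Qed.

Let antipodel_bilin : bilinear_map (fun h1 h2 : H => S h1 * h2).
Proof.
split=> [b|s] c x y /=; first by rewrite S_lin mulrDl scalerAl.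
by rewrite mulrDr scalerAr.
Qed.

Let antipoder_bilin : bilinear_map (fun h1 h2 : H => h1 * S h2).
Proof.
split=> [b|s] c x y /=; first by rewrite mulrDl scalerAl.
by rewrite S_lin mulrDr scalerAr.
Qed.

Lemma lifting_antipodel (h : H) :
  tlift (fun h1 h2 => S h1 * h2) (Delta h) = (eps h)%:A.
Proof.
elim/lifting_ind: h => [g|i|c|s t IHs IHt|s t IHs IHt].
- by rewrite Delta_g tlift_tpure // S_g eps_g lifting_gV scale1r.
- rewrite Delta_x tliftD // !tlift_tpure // S_x S_g mulr1 eps_x scale0r.
  by rewrite addNr.
- by rewrite DeltaZ Delta1 epsZ tliftZ // tlift_tpure // S1 mulr1 eps1 mulr1.
- by rewrite DeltaD tliftD // IHs IHt epsD scalerDl.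
rewrite DeltaM epsM -scalerA -IHt.
elim/tensor_ind: (Delta t) => [|c d|r r' IHr IHr'].
- by rewrite mulr0 !tlift0 // scaler0.
- rewrite tlift_tpure //.
  transitivity (S c * tlift (fun h1 h2 => S h1 * h2) (Delta s) * d).
    elim/tensor_ind: (Delta s) => [|e f|r r' IHr IHr'].
    + by rewrite mul0r tlift0 // mulr0 mul0r.
    + by rewrite tensorM !tlift_tpure // SM !mulrA.
    + by rewrite mulrDl !tliftD // IHr IHr' mulrDr mulrDl.
  by rewrite IHs -scalerAr mulr1 -scalerAl.
- by rewrite mulrDr !tliftD // IHr IHr' scalerDr.
Qed.

Lemma lifting_antipoder (h : H) :
  tlift (fun h1 h2 => h1 * S h2) (Delta h) = (eps h)%:A.
Proof.
elim/lifting_ind: h => [g|i|c|s t IHs IHt|s t IHs IHt].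
- by rewrite Delta_g tlift_tpure // S_g eps_g lifting_gVr scale1r.
- rewrite Delta_x tliftD // !tlift_tpure // S_x S1 mulr1 eps_x scale0r.
  by rewrite mulrN mulrA lifting_gVr mul1r addrN.
- by rewrite DeltaZ Delta1 epsZ tliftZ // tlift_tpure // S1 mulr1 eps1 mulr1.
- by rewrite DeltaD tliftD // IHs IHt epsD scalerDl.
rewrite DeltaM epsM mulrC -scalerA -IHs.
elim/tensor_ind: (Delta s) => [|c d|r r' IHr IHr'].
- by rewrite mul0r !tlift0 // scaler0.
- rewrite tlift_tpure //.
  transitivity (c * tlift (fun h1 h2 => h1 * S h2) (Delta t) * S d).
    elim/tensor_ind: (Delta t) => [|e f|r r' IHr IHr'].
    + by rewrite mulr0 tlift0 // mulr0 mul0r.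
    + by rewrite tensorM !tlift_tpure // SM !mulrA.
    + by rewrite mulrDr !tliftD // IHr IHr' mulrDr mulrDl.
  by rewrite IHt -scalerAr mulr1 -scalerAl.
- by rewrite mulrDl !tliftD // IHr IHr' scalerDr.
Qed.

HB.instance Definition _ := Algebra_isHopf.Build F H
  lifting_comul_linear lifting_comul_monoid_morphism
  lifting_counit_linear lifting_counit_monoid_morphism S_lin
  lifting_comulA lifting_counitl lifting_counitr
  lifting_antipodel lifting_antipoder.

Lemma lifting_comul_g g : comul (g_ g) = g_ g \ox g_ g.
Proof. exact: Delta_g. Qed.

Lemma lifting_comul_x i : comul (x_ i) = x_ i \ox 1 + g_ (a i) \ox x_ i.
Proof. exact: Delta_x. Qed.

Lemma lifting_counit_g g : counit (g_ g) = 1.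
Proof. exact: eps_g. Qed.

Lemma lifting_counit_x i : counit (x_ i) = 0.
Proof. exact: eps_x. Qed.

Lemma lifting_antipode_g g : antipode (g_ g) = g_ g^-1%g.
Proof. exact: S_g. Qed.

Lemma lifting_antipode_x i : antipode (x_ i) = - (g_ (a i)^-1%g * x_ i).
Proof. exact: S_x. Qed.

End LiftingHopf.

(* Main.v *)
(* The action of [g x_i g^-1 = chi_i(g) x_i], computed through [u], shows that
   the plane spanned by [u (x_i)] and [u (a_i)] is stable under conjugation by
   [u g], with [u (a_i)] an eigenvector.  Since [u (a_i)] commutes with itself
   while [chi_i(a_i) = q_i != 1], the operator given by [a_i] is diagonalizable
   on this plane, and, as [G] is abelian, [y_i = u (x_i) + c_i u (a_i)] is a
   [chi_i]-eigenvector for all of [G] if [c_i] is suitably chosen.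

   Convolving [u] with a convolution invertible [gamma : H -> F] does not change
   the action, and replaces [u (x_i)] by [y_i] if [gamma g = 1] on [G] and
   [gamma (x_i) = c_i].  Such a linear [gamma] exists without any knowledge of a
   basis of [H]: the [c_i] can be read off linearly from the convolution inverse
   of [u] (see [inner_functional]).  It is invertible because [gamma - counit]
   vanishes on the span of [G], hence is locally nilpotent for the filtration of
   [H] by the number of factors [x_i]. *)
Require Import Defs.
From HB Require Import structures.
From mathcomp Require Import all_boot all_order all_fingroup all_algebra.
From mathcomp Require Import ring boolp.

Set Implicit Arguments.
Unset Strict Implicit.
Unset Printing Implicit Defensive.

Import GRing.Theory.
Local Open Scope ring_scope.

(** * Bare linear functions and central matrices *)

Section LinearFunctions.
Variables (F : fieldType) (U V : lmodType F) (f : U -> V).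
Hypothesis lf : linear f.

(** Convolutions are built as bare functions, while [inner_via] asks for bundled linear maps. *)
Lemma linear_fun_exists : exists g : {linear U -> V}, g =1 f.
Proof.
pose m := GRing.isLinear.Build F U V *:%R f lf.
by exists (HB.pack_for {linear U -> V} f m).
Qed.

Lemma linfun_add s t : f (s + t) = f s + f t.
Proof. by have := lf 1 s t; rewrite !scale1r. Qed.
Lemma linfun_zero : f 0 = 0.
Proof. by apply: (addrI (f 0)); rewrite -linfun_add !addr0. Qed.
Lemma linfun_scale c s : f (c *: s) = c *: f s.
Proof. by have := lf c s 0; rewrite linfun_zero !addr0. Qed.
Lemma linfun_sub s t : f (s - t) = f s - f t.
Proof. by rewrite -!scaleN1r linfun_add linfun_scale. Qed.

End LinearFunctions.

(** Comparing the entries [(i, 0)] of the two products of [z] with the matrix unit [delta_mx j 0]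
    gives [z i j = 0] for [i != j] and [z j j = z 0 0]. *)
Lemma central_mx_scalar (F : fieldType) (m : nat) (z : 'M[F]_m.+1) :
  (forall b, z * b = b * z) -> z = (z 0 0)%:A.
Proof.
move=> zC; apply/matrixP => i j.
have : (z *m delta_mx j (0 : 'I_m.+1)) i 0 = (delta_mx j 0 *m z) i 0.
  by have e := zC (delta_mx j 0); rewrite -[_ *m _]/(z * delta_mx j 0) e.
rewrite !mxE (bigD1 j) //= [X in _ = X](bigD1 0) //= !mxE !eqxx.
rewrite !big1 ?addr0 => [|k kn|k kn]; first last.
- by rewrite mxE (negPf kn) mulr0.
- by rewrite mxE (negPf kn) andbF mul0r.
by rewrite mulr1 andbT mulrC.
Qed.

Lemma tlift_fun0 (F : fieldType) (A B V : lmodType F) (t : tensor A B) :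
  tlift (fun _ _ => 0 : V) t = 0.
Proof.
rewrite (tlift_fun_linear (f := fun _ _ => 0) (g := fun _ _ => 0) (c := -1)) => [|_ _].
  by rewrite scaleN1r addNr.
by rewrite scaler0 addr0.
Qed.

(** * The convolution algebra of linear maps from [H] to [A] *)

Section Convolution.
Variables (F : fieldType) (H : hopfAlgType F) (A : algType F).
Implicit Types (f g k : H -> A).

Lemma conv_bilin f g :
  linear f -> linear g -> bilinear_map (fun h1 h2 => f h1 * g h2).
Proof.
move=> lf lg; split=> [b|s] c x y /=; first by rewrite lf mulrDl scalerAl.
by rewrite lg mulrDr scalerAr.
Qed.

Lemma conv_linear f g : linear f -> linear g -> linear (convolution f g).
Proof.
move=> lf lg c s t; rewrite /convolution comul_linear.
exact: (tlift_linear (conv_bilin lf lg)).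
Qed.

Lemma eq_conv f f' g g' : f =1 f' -> g =1 g' -> convolution f g =1 convolution f' g'.
Proof. by move=> ff gg h; apply: eq_tlift => b c; rewrite ff gg. Qed.

Lemma convA f g k : linear f -> linear g -> linear k ->
  convolution (convolution f g) k =1 convolution f (convolution g k).
Proof.
move=> lf lg lk h.
(* [phi] sends [b \ox (c \ox d)] to [f b * (g c * k d)]; associativity is the image of [comulA]
   under it. *)
pose phi := tlift (fun b (t : tensor H H) => f b * tlift (fun c d => g c * k d) t).
have phi_bilin : bilinear_map
    (fun b (t : tensor H H) => f b * tlift (fun c d => g c * k d) t).
  split=> [t|b] c x y /=; first by rewrite lf mulrDl scalerAl.
  by rewrite (tlift_linear (conv_bilin lg lk)) mulrDr scalerAr.
have lphi : linear phi by apply: tlift_linear.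
have := congr1 phi (comulA h); rewrite !(tlift_comp _ _ lphi) => e.
have -> : convolution f (convolution g k) h
          = tlift (fun b c => phi (b \ox comul c)) (comul h).
  by apply: eq_tlift => b c; rewrite /phi tlift_tpure.
rewrite -e; apply: eq_tlift => b c; rewrite (tlift_comp _ _ lphi).
  have lr : linear (fun a : A => a * k c).
    by move=> r x y; rewrite mulrDl scalerAl.
  rewrite (tlift_comp _ _ lr); apply: eq_tlift => b1 b2.
  rewrite /phi tlift_tpure // tlift_tpure ?mulrA //; exact: conv_bilin.
Qed.

Definition conv1 (h : H) : A := (counit h)%:A.

Lemma conv1_linear : linear conv1.
Proof. by move=> c s t; rewrite /conv1 counit_linear scalerDl scalerA. Qed.

Lemma convf1 f : linear f -> convolution f conv1 =1 f.
Proof.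
move=> lf h; rewrite -{2}(counitr h) (tlift_comp _ _ lf).
by apply: eq_tlift => b c; rewrite (linfun_scale lf) -scalerAr mulr1.
Qed.

Lemma conv1f f : linear f -> convolution conv1 f =1 f.
Proof.
move=> lf h; rewrite -{2}(counitl h) (tlift_comp _ _ lf).
by apply: eq_tlift => b c; rewrite (linfun_scale lf) -scalerAl mul1r.
Qed.

Lemma convDl f f' g h :
  convolution (f \+ f') g h = convolution f g h + convolution f' g h.
Proof.
rewrite /convolution -[X in X + _]scale1r; apply: tlift_fun_linear => b c.
by rewrite scale1r mulrDl.
Qed.

Lemma convDr f g g' h :
  convolution f (g \+ g') h = convolution f g h + convolution f g' h.
Proof.
rewrite /convolution -[X in X + _]scale1r; apply: tlift_fun_linear => b c.
by rewrite scale1r mulrDr.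
Qed.

End Convolution.
Arguments conv1 {F H A}.

(** * Inverting [conv1 \+ delta] for locally nilpotent [delta] *)

Section ConvolutionInverse.
Variables (F : fieldType) (H : hopfAlgType F) (A : algType F).
Variable delta : H -> A.
Hypothesis delta_linear : linear delta.

Definition convpow (k : nat) : H -> A := iter k (convolution delta) conv1.

Hypothesis delta_nilp : forall h, exists n, forall k, (n <= k)%N -> convpow k h = 0.

Lemma convpow_linear k : linear (convpow k).
Proof. by elim: k => [|k IHk]; [apply: conv1_linear | apply: conv_linear]. Qed.

Lemma convpowSr k : convpow k.+1 =1 convolution (convpow k) delta.
Proof.
elim: k => [|k IHk] h; first by rewrite [LHS]convf1 // conv1f.
rewrite [LHS](eq_conv (fun=> erefl) IHk) -convA //; exact: convpow_linear.
Qed.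

(** Truncated geometric series for the inverse of [conv1 \+ delta]. *)
Definition conv_geom (n : nat) (h : H) : A :=
  \sum_(0 <= k < n) (-1) ^+ k *: convpow k h.

Lemma conv_geomS n h : conv_geom n.+1 h = (-1) ^+ n *: convpow n h + conv_geom n h.
Proof. by rewrite /conv_geom big_nat_recr //= addrC. Qed.

Lemma conv_geom0 h : conv_geom 0 h = 0.
Proof. by rewrite /conv_geom big_geq. Qed.

Lemma conv_geom_linear n : linear (conv_geom n).
Proof.
move=> c s t; rewrite /conv_geom scaler_sumr -big_split; apply: eq_bigr => k _.
by rewrite convpow_linear scalerDr !scalerA mulrC.
Qed.

Lemma conv_geomr n h :
  convolution (conv1 \+ delta) (conv_geom n) h = conv1 h - (-1) ^+ n *: convpow n h.
Proof.
rewrite convDl conv1f; last exact: conv_geom_linear.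
elim: n => [|n IHn].
  rewrite conv_geom0 add0r scale1r subrr /convolution.
  rewrite -[RHS](tlift_fun0 A (comul h)).
  by apply: eq_tlift => b c; rewrite conv_geom0 mulr0.
have -> : convolution delta (conv_geom n.+1) h
        = (-1) ^+ n *: convpow n.+1 h + convolution delta (conv_geom n) h.
  by apply: tlift_fun_linear => b c; rewrite conv_geomS mulrDr scalerAr.
by rewrite conv_geomS addrACA IHn [LHS]addrC addrA addrNK exprS mulN1r scaleNr opprK.
Qed.

Lemma conv_geoml n h :
  convolution (conv_geom n) (conv1 \+ delta) h = conv1 h - (-1) ^+ n *: convpow n h.
Proof.
rewrite -conv_geomr convDl convDr convf1 ?conv1f; try exact: conv_geom_linear.
(* What remains is that [delta] commutes with its truncated series; [convpowSr] gives this term by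
   term. *)
congr (_ + _); elim: n => [|n IHn].
  rewrite /convolution; transitivity (tlift (fun _ _ : H => 0 : A) (comul h)).
    by apply: eq_tlift => b c; rewrite conv_geom0 mul0r.
  by apply: eq_tlift => b c; rewrite conv_geom0 mulr0.
have -> : convolution delta (conv_geom n.+1) h
        = (-1) ^+ n *: convpow n.+1 h + convolution delta (conv_geom n) h.
  by apply: tlift_fun_linear => b c; rewrite conv_geomS mulrDr scalerAr.
rewrite convpowSr -IHn.
by apply: tlift_fun_linear => b c; rewrite conv_geomS mulrDl scalerAl.
Qed.

(** Only finitely many powers of [delta] survive at each [h], so the geometric series has a sum
    [w h] there, though no single truncation need serve all [h]. *)
Lemma conv_inverse_exists :
  exists w, linear w /\ convolution_inverse (conv1 \+ delta) w.
Proof.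
have [N NP] := boolp.choice delta_nilp.
pose w h := conv_geom (N h) h.
have wE h n : (N h <= n)%N -> w h = conv_geom n h.
  move=> Nn; rewrite /w /conv_geom (big_cat_nat _ Nn) //= [X in _ + X]big_nat_cond.
  by rewrite [X in _ + X]big1 ?addr0 // => k /andP[/andP[Nk _] _]; rewrite NP // scaler0.
have lw : linear w.
  move=> c s t; pose M := maxn (N (c *: s + t)) (maxn (N s) (N t)).
  rewrite (wE _ M) ?(wE s M) ?(wE t M) ?conv_geom_linear //; rewrite /M !leq_max leqnn ?orbT //.
(* A tensor is a finite sum of pure tensors, so one truncation can replace [w] throughout it. *)
have wlim (t : tensor H H) (f : H -> A) : linear f -> exists n, forall k, (n <= k)%N ->
    tlift (fun b c => f b * w c) t = tlift (fun b c => f b * conv_geom k c) t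
    /\ tlift (fun b c => w b * f c) t = tlift (fun b c => conv_geom k b * f c) t.
  move=> lf; elim/tensor_ind: t => [|b c|s t [n sE] [n' tE]].
  - exists 0%N => k _; rewrite !tlift0 //; apply: conv_bilin => //; exact: conv_geom_linear.
  - exists (maxn (N b) (N c)) => k; rewrite geq_max => /andP[Nb Nc].
    by rewrite !tlift_tpure ?(wE b k) ?(wE c k) //; apply: conv_bilin => //; exact: conv_geom_linear.
  - exists (maxn n n') => k; rewrite geq_max => /andP[nk n'k].
    have [s1 s2] := sE k nk; have [t1 t2] := tE k n'k.
    by rewrite !tliftD ?s1 ?s2 ?t1 ?t2 //; apply: conv_bilin => //; exact: conv_geom_linear.
have l1d : linear (conv1 \+ delta).
  move=> c s t; rewrite /=.
  by rewrite delta_linear conv1_linear scalerDr addrACA.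
exists w; split=> // h; have [n nE] := wlim (comul h) _ l1d.
pose M := maxn n (N h); have [e1 e2] := nE M (leq_maxl _ _).
have hM : convpow M h = 0 by apply: NP; apply: leq_maxr.
by rewrite /convolution e1 e2; split; [move: (conv_geomr M h)|move: (conv_geoml M h)];
   rewrite hM scaler0 subr0.
Qed.

End ConvolutionInverse.

(** * Twisting an inner action by an invertible map with central values *)

Section Twist.
Variables (F : fieldType) (H : hopfAlgType F) (A : algType F).
Variables (act : H -> A -> A) (u : {linear H -> A}).

(** The inverse of [u] convolved with [gamma] is [w] convolved with [v]; having central values,
    [gamma] moves past [a] and cancels against [w]. *)
Lemma inner_via_twist (gamma w : H -> A) : inner_via u act ->
    linear gamma -> linear w -> convolution_inverse gamma w ->
    gamma 1 = 1 -> (forall h a, gamma h * a = a * gamma h) ->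
  exists u' : {linear H -> A}, inner_via u' act /\ u' =1 convolution u gamma.
Proof.
move=> [u1 [v [uv actE]]] lg lw gw g1 gC.
have lu : linear u by apply: linearP.
have lv : linear v by apply: linearP.
have [u' u'E] := linear_fun_exists (conv_linear lu lg).
have [v' v'E] := linear_fun_exists (conv_linear lw lv).
have cancel_mid (f k k' g : H -> A) : linear f -> linear k -> linear k' -> linear g ->
    (forall h, convolution k k' h = conv1 h) ->
    convolution (convolution f k) (convolution k' g) =1 convolution f g.
  move=> lf lk lk' lg' kk' h; rewrite convA //; last exact: conv_linear.
  apply: eq_conv => // x; rewrite -convA // -[RHS](conv1f lg').
  exact: eq_conv.
exists u'; split=> //; split.
  rewrite u'E /convolution (comul_monoid_morphism (s := H)).1 tensor1.
  by rewrite tlift_tpure ?u1 ?g1 ?mulr1 //; apply: conv_bilin.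
exists v'; split=> h.
  split; rewrite (eq_conv u'E v'E) || rewrite (eq_conv v'E u'E).
    by rewrite cancel_mid // => [|x]; [case: (uv h) | case: (gw x)].
  by rewrite cancel_mid // => [|x]; [case: (gw h) | case: (uv x)].
move=> a; rewrite actE.
have lua : linear (fun x => u x * a) by move=> c s t; rewrite lu mulrDl scalerAl.
(* For fixed [a] the action is the convolution of [fun x => u x * a] with [v], so [gamma] and [w]
   can be inserted between them. *)
transitivity (convolution (convolution (fun x => u x * a) gamma) (convolution w v) h).
  by rewrite cancel_mid // => x; case: (gw x).
have lr : linear (fun b : A => b * a) by move=> c s t; rewrite mulrDl scalerAl.
apply: eq_conv => [x|x]; last by rewrite v'E.
rewrite u'E (tlift_comp _ _ lr); apply: eq_tlift => b c.
by rewrite -!mulrA gC.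
Qed.

End Twist.

(** [P] is the composite of the maps [(1 - q i)^-1 (T i - q i)] for [i] in [r]: each fixes the
    common fixed vectors, and the factor of index [i] kills the eigenvectors of [T i] for [q i]. *)
Lemma eigen_separation (F : fieldType) (V : lmodType F) (I : eqType)
    (T : I -> V -> V) (q : I -> F) (r : seq I) :
    (forall i, linear (T i)) -> (forall i j v, T i (T j v) = T j (T i v)) ->
    (forall i, q i != 1) ->
  exists P : V -> V, [/\ linear P, forall v, (forall i, T i v = v) -> P v = v
    & forall i v, i \in r -> T i v = q i *: v -> P v = 0].
Proof.
move=> lT TC q1.
(* The induction also carries commutation with every [T i], because a new factor is applied after
   [P] and must still meet an eigenvector. *)
suff [P [lP _ Pfix Pker]] : exists P : V -> V, [/\ linear P,
    forall i v, T i (P v) = P (T i v), forall v, (forall i, T i v = v) -> P v = v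
    & forall i v, i \in r -> T i v = q i *: v -> P v = 0] by exists P.
elim: r => [|i r [P [lP PC Pfix Pker]]]; first by exists id.
exists (fun v => (1 - q i)^-1 *: (T i (P v) - q i *: P v)); split.
- move=> c s t; rewrite lP lT scalerA mulrC -scalerA -scalerDr.
  congr (_ *: _); rewrite scalerBr scalerDr opprD !scalerA mulrC.
  by rewrite addrACA.
- move=> j v; rewrite (linfun_scale (lT j)); congr (_ *: _).
  rewrite -scaleN1r (linfun_add (lT j)) !(linfun_scale (lT j)) TC PC.
  by rewrite scaleN1r.
- move=> v Tv; rewrite Pfix // Tv -{1}(scale1r v) -scalerBl scalerA mulVf ?scale1r //.
  by rewrite subr_eq0 eq_sym.
- move=> j v; rewrite inE => /predU1P[-> Tv|jr Tv].
    by rewrite PC Tv (linfun_scale lP) subrr scaler0.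
  by rewrite (Pker j) // (linfun_zero (lT i)) scaler0 subrr scaler0.
Qed.

(** * Filtration of [H] by the number of factors [x_i] *)

Section Filtration.
Variables (F : fieldType) (gT : finGroupType) (n : nat).
Variables (R : qls F gT n) (D : compatible_datum R).
Local Notation H := (lifting D).

(** Given by closure rules, since the relations of [H] need not be homogeneous and only upper bounds
    matter. *)
Inductive x_degree_le : nat -> H -> Prop :=
| x_degree_g g : x_degree_le 0 (lifting_g D g)
| x_degree_x i : x_degree_le 1 (lifting_x D i)
| x_degree_c c : x_degree_le 0 (c%:A)
| x_degree_D k s t : x_degree_le k s -> x_degree_le k t -> x_degree_le k (s + t)
| x_degree_M j k s t :
    x_degree_le j s -> x_degree_le k t -> x_degree_le (j + k) (s * t)
| x_degree_W j k s : (j <= k)%N -> x_degree_le j s -> x_degree_le k s.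

Inductive tensor_degree_le (k : nat) : tensor H H -> Prop :=
| tensor_degree_0 : tensor_degree_le k 0
| tensor_degree_pure i j s t : x_degree_le i s -> x_degree_le j t ->
    (i + j <= k)%N -> tensor_degree_le k (s \ox t)
| tensor_degree_D s t :
    tensor_degree_le k s -> tensor_degree_le k t -> tensor_degree_le k (s + t).

Lemma x_degree_exists (h : H) : exists k, x_degree_le k h.
Proof.
elim/lifting_ind: h => [g|i|c|s t [j sj] [k tk]|s t [j sj] [k tk]].
- by exists 0%N; constructor.
- by exists 1%N; constructor.
- by exists 0%N; constructor.
- exists (maxn j k); apply: x_degree_D.
    exact: x_degree_W (leq_maxl _ _) sj.
  exact: x_degree_W (leq_maxr _ _) tk.
- by exists (j + k)%N; constructor.
Qed.

Lemma tensor_degree_W j k t :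
  (j <= k)%N -> tensor_degree_le j t -> tensor_degree_le k t.
Proof.
move=> jk; elim=> [|i i' s s' si si' ij|s s' _ IHs _ IHs'].
- exact: tensor_degree_0.
- exact: tensor_degree_pure si si' (leq_trans ij jk).
- exact: tensor_degree_D.
Qed.

Lemma tensor_degree_M j k s t :
  tensor_degree_le j s -> tensor_degree_le k t -> tensor_degree_le (j + k) (s * t).
Proof.
move=> sj tk; elim: sj => [|i i' s1 s2 d1 d2 le12|s1 s2 _ IH1 _ IH2].
- by rewrite mul0r; apply: tensor_degree_0.
- elim: tk => [|l l' t1 t2 e1 e2 le12'|t1 t2 _ IH1 _ IH2].
  + by rewrite mulr0; apply: tensor_degree_0.
  + rewrite tensorM; apply: tensor_degree_pure (x_degree_M d1 e1) (x_degree_M d2 e2) _.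
    by rewrite addnACA leq_add.
  + by rewrite mulrDr; apply: tensor_degree_D.
- by rewrite mulrDl; apply: tensor_degree_D.
Qed.

(** The coproduct is an algebra morphism, and both terms of [comul (x_i)] have total degree at most
    1. *)
Lemma comul_degree k h : x_degree_le k h -> tensor_degree_le k (comul h).
Proof.
have d1 : x_degree_le 0 (1 : H) by have := x_degree_c 1; rewrite scale1r.
elim=> {k h} [g|i|c|k s t _ IHs _ IHt|j k s t _ IHs _ IHt|j k s jk _ IHs].
- rewrite lifting_comul_g.
  exact: tensor_degree_pure (x_degree_g _) (x_degree_g _) _.
- rewrite lifting_comul_x; apply: tensor_degree_D.
    exact: tensor_degree_pure (x_degree_x _) d1 _.
  exact: tensor_degree_pure (x_degree_g _) (x_degree_x _) _.
- rewrite (linfun_scale (@comul_linear F H)) (comul_monoid_morphism (s := H)).1.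
  rewrite tensor1 -tpureZl; exact: tensor_degree_pure (x_degree_c _) d1 _.
- by rewrite (linfun_add (@comul_linear F H)); apply: tensor_degree_D.
- by rewrite (comul_monoid_morphism (s := H)).2; apply: tensor_degree_M.
- exact: tensor_degree_W jk IHs.
Qed.

(** Elements of degree zero lie in the span of the group elements. *)
Lemma x_degree0_vanish (V : lmodType F) (f : H -> V) (h : H) : linear f ->
  (forall g, f (lifting_g D g) = 0) -> x_degree_le 0 h -> f h = 0.
Proof.
(* [f] is generalized because a product [s * t] is treated through [f (s * _)] on [t], then
   [f (_ * g)] on [s]. *)
move=> + + h0; suff vanish k (hk : x_degree_le k h) : k = 0%N ->
    forall f : H -> V, linear f -> (forall g, f (lifting_g D g) = 0) -> f h = 0.
  exact: vanish h0 (erefl _) f.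
elim: hk => {h h0 f k} [g|i|c|k s t _ IHs _ IHt|j k s t _ IHs _ IHt|j k s jk _ IHs] k0 f lf fg //.
- by rewrite (linfun_scale lf) -(lifting_g1 D) fg scaler0.
- by rewrite (linfun_add lf) IHs ?IHt ?addr0.
- have [j0 k0'] : j = 0%N /\ k = 0%N by case: j k k0 {IHs IHt} => [|j] [|k].
  apply: (IHt _ (fun t => f (s * t))) => // [c x y|g].
    by rewrite mulrDr -scalerAr lf.
  apply: (IHs _ (fun s => f (s * lifting_g D g))) => // [c x y|g'].
    by rewrite mulrDl -scalerAl lf.
  by rewrite -lifting_gM fg.
- by apply: IHs => //; move: jk; rewrite k0 leqn0 => /eqP.
Qed.

(** Powers with exponent above the degree of [h] vanish: in each term
    [delta h1 * convpow delta l h2], either [h1] has degree zero and [delta] kills it, or [h2] has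
    smaller degree than [h]. *)
Lemma convpow_nilpotent (A : algType F) (delta : H -> A) : linear delta ->
    (forall g, delta (lifting_g D g) = 0) ->
  forall h, exists k, forall l, (k <= l)%N -> convpow delta l h = 0.
Proof.
move=> ld dg h; have [k hk] := x_degree_exists h; exists k.+1.
move=> l; elim: l k h hk => // l IHl k h /comul_degree hk; rewrite ltnS => kl.
have lB : bilinear_map (fun h1 h2 => delta h1 * convpow delta l h2).
  by apply: conv_bilin => //; apply: convpow_linear.
rewrite -[LHS]/(tlift (fun h1 h2 => delta h1 * convpow delta l h2) (comul h)).
elim: hk => [|i j s t si tj ij|s t _ IHs _ IHt].
- exact: tlift0.
- rewrite tlift_tpure //; case: i si ij => [|i] si ij.
    by rewrite (x_degree0_vanish ld) ?mul0r.
  rewrite (IHl j _ tj) ?mulr0 //; apply: leq_trans kl; apply: leq_trans ij.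
  by rewrite addSn ltnS leq_addl.
- by rewrite tliftD // IHs IHt addr0.
Qed.

End Filtration.

(** * Conjugation by the images of group elements *)

Section InnerAction.
Variables (F : fieldType) (gT : finGroupType) (n : nat).
Variables (R : qls F gT n) (D : compatible_datum R) (m : nat).
Local Notation H := (lifting D).
Local Notation A := 'M[F]_m.+1.
Variables (act : H -> A -> A) (u v : {linear H -> A}).
Hypothesis act_action : module_algebra act.
Hypothesis u1 : u 1 = 1.
Hypothesis uv : convolution_inverse u v.
Hypothesis actE : forall h a, act h a = tlift (fun h1 h2 => u h1 * a * v h2) (comul h).
Local Notation g_ := (lifting_g D).
Local Notation x_ := (lifting_x D).
Local Notation chi := (qls_chi R).
Local Notation a := (qls_a R).
Local Notation q := (qls_q R).

Let lu : linear u. Proof. exact: linearP. Qed.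
Let lv : linear v. Proof. exact: linearP. Qed.

Lemma inner_gVr g : u (g_ g) * v (g_ g) = 1.
Proof.
have [+ _] := uv (g_ g); rewrite /convolution lifting_comul_g lifting_counit_g scale1r.
by rewrite tlift_tpure //; apply: conv_bilin.
Qed.

Lemma inner_gVl g : v (g_ g) * u (g_ g) = 1.
Proof.
have [_] := uv (g_ g); rewrite /convolution lifting_comul_g lifting_counit_g scale1r.
by rewrite tlift_tpure //; apply: conv_bilin.
Qed.

Lemma inner_gV g : (u (g_ g))^-1 = v (g_ g).
Proof.
have Ug : u (g_ g) \is a GRing.unit.
  by apply/unitrP; exists (v (g_ g)); rewrite inner_gVr inner_gVl.
by rewrite -[LHS]mulr1 -(inner_gVr g) mulKr.
Qed.

Lemma inner_x i : v (x_ i) = - (v (g_ (a i)) * u (x_ i)).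
Proof.
have [_] := uv (x_ i); rewrite /convolution lifting_comul_x lifting_counit_x scale0r.
rewrite tliftD ?tlift_tpure ?u1 ?mulr1; try exact: conv_bilin.
by move/eqP; rewrite addr_eq0 => /eqP.
Qed.

Let act_bilin b : bilinear_map (fun h1 h2 => u h1 * b * v h2).
Proof.
split=> [h|h] c x y /=; first by rewrite lu !mulrDl !scalerAl.
by rewrite lv mulrDr scalerAr.
Qed.

Lemma inner_act_g g b : act (g_ g) b = u (g_ g) * b * v (g_ g).
Proof. by rewrite actE lifting_comul_g tlift_tpure. Qed.

Lemma inner_act_x i b :
  act (x_ i) b = u (x_ i) * b - u (g_ (a i)) * b * v (g_ (a i)) * u (x_ i).
Proof.
have v1 : v 1 = 1.
  by have := inner_gVr 1%g; rewrite !lifting_g1 u1 mul1r.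
rewrite actE lifting_comul_x tliftD // !tlift_tpure // v1 mulr1 inner_x mulrN.
by rewrite !mulrA.
Qed.

Lemma inner_act_mul g b c : act (g_ g) (b * c) = act (g_ g) b * act (g_ g) c.
Proof.
rewrite !inner_act_g -!mulrA; do 2 congr (_ * _).
by rewrite !mulrA inner_gVl mul1r.
Qed.

Lemma inner_act_gK g b : act (g_ g) (act (g_ g^-1%g) b) = b.
Proof. by rewrite -(act_M act_action) lifting_gVr (act_1 act_action). Qed.

Lemma inner_act_gC g k b : act (g_ g) (act (g_ k) b) = act (g_ k) (act (g_ g) b).
Proof. by rewrite -!(act_M act_action) lifting_gC. Qed.

(** The factor [v (g_ k)] undoes the twist: [v (g_ k) * z] is central in a full matrix algebra,
    hence scalar. *)
Lemma inner_twisted_scalar k (z : A) :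
    (forall b, z * b = u (g_ k) * b * v (g_ k) * z) ->
  exists c : F, z = c *: u (g_ k).
Proof.
move=> zE; pose y := v (g_ k) * z.
have yC b : y * b = b * y by rewrite /y -mulrA zE !mulrA inner_gVl mul1r.
exists (y 0 0); rewrite -[LHS]mul1r -(inner_gVr k) -mulrA -/y.
by rewrite (central_mx_scalar yC) -scalerAr mulr1 !mxE eqxx mulr1.
Qed.

(** As [G] is abelian, the actions of [g] and [k] commute, so [u (g_ k)] and its conjugate by
    [u (g_ g)] define the same inner automorphism. *)
Lemma inner_conj_g g k : exists c : F, act (g_ g) (u (g_ k)) = c *: u (g_ k).
Proof.
apply: inner_twisted_scalar => b; set z := act _ _.
have zV : act (g_ g) (v (g_ k)) * z = 1.
  by rewrite -inner_act_mul inner_gVl inner_act_g mulr1 inner_gVr.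
rewrite -(inner_act_g k b) -[in RHS](inner_act_gK g b) inner_act_gC.
rewrite (inner_act_g k) !inner_act_mul inner_act_gK -/z.
by rewrite -!mulrA zV mulr1.
Qed.

(* Transporting the action of [g x_i g^-1] through [u] turns it into the same
   expression as that of [x_i], with [u (x_i)] conjugated by [u g]; comparing
   with [chi_i(g) x_i], the difference times [u (a_i)^-1] is central. *)
Lemma inner_conj_x g i : exists lam : F,
  act (g_ g) (u (x_ i)) = chi i g *: u (x_ i) + lam *: u (g_ (a i)).
Proof.
pose w := act (g_ g) (u (x_ i)); pose z := w - chi i g *: u (x_ i).
have gx b : act (g_ g) (act (x_ i) (act (g_ g^-1%g) b)) = chi i g *: act (x_ i) b.
  rewrite -!(act_M act_action) lifting_gx -scalerAl -mulrA lifting_gVr mulr1.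
  exact: (linfun_scale (act_linearl act_action b)).
have wE b : act (g_ g) (act (x_ i) (act (g_ g^-1%g) b))
          = w * b - u (g_ (a i)) * b * v (g_ (a i)) * w.
  rewrite inner_act_x (linfun_sub (act_linearr act_action (g_ g))).
  rewrite -inner_act_g !inner_act_mul (inner_act_gC g (a i)) !inner_act_gK.
  by rewrite (inner_act_g (a i)).
have [b|lam zE] := @inner_twisted_scalar (a i) z; last first.
  by exists lam; rewrite -zE addrC subrK.
have := gx b; rewrite wE inner_act_x scalerBr => e.
rewrite /z mulrBl mulrBr -scalerAl -scalerAr.
rewrite -[w * b](subrK (u (g_ (a i)) * b * v (g_ (a i)) * w)) e.
by rewrite [LHS]addrC -!addrA addKr addrC.
Qed.

Lemma inner_eigen i : exists c : F, forall g,
  act (g_ g) (u (x_ i) + c *: u (g_ (a i)))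
  = chi i g *: (u (x_ i) + c *: u (g_ (a i))).
Proof.
have [lam lamE] := inner_conj_x (a i) i.
have q1 : q i - 1 != 0 by rewrite subr_eq0 qls_neq1.
(* This [c] solves [lam + c = q i * c], which makes [y] an eigenvector of the action of [a i]. *)
exists (lam / (q i - 1)); set c := lam / _; set y := _ + _ => g.
have lact k : linear (act (g_ k)) := act_linearr act_action (g_ k).
have aa : act (g_ (a i)) (u (g_ (a i))) = u (g_ (a i)).
  by rewrite inner_act_g -mulrA inner_gVr mulr1.
have ay : act (g_ (a i)) y = q i *: y.
  rewrite /y (linfun_add (lact _)) (linfun_scale (lact _)) aa lamE scalerDr -addrA.
  congr (_ + _); rewrite -scalerDl scalerA; congr (_ *: _).
  have -> : lam = c * (q i - 1) by rewrite /c divfK.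
  by rewrite mulrBr mulr1 addrNK mulrC.
have [mu gy] : exists mu, act (g_ g) y = chi i g *: y + mu *: u (g_ (a i)).
  have [lam' lam'E] := inner_conj_x g i.
  have [s sE] : exists s, act (g_ g) (u (g_ (a i))) = s *: u (g_ (a i)).
    exact: inner_conj_g.
  exists (lam' + c * s - chi i g * c).
  rewrite /y (linfun_add (lact _)) (linfun_scale (lact _)) sE lam'E.
  rewrite scalerDr -!addrA; congr (_ + _); rewrite !scalerA -!scalerDl.
  by congr (_ *: _); ring.
(* Acting on [y] by [g] and [a i] in both orders leaves [q i * mu = mu] as coefficients of
   [u (g_ (a i))], which is invertible and hence nonzero. *)
have := inner_act_gC g (a i) y.
rewrite ay gy (linfun_scale (lact _)) gy (linfun_add (lact _)) !(linfun_scale (lact _)).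
rewrite aa ay scalerDr !scalerA mulrC => /addrI /eqP.
rewrite -subr_eq0 -scalerBl scaler_eq0 => /orP[|/eqP ua0]; last first.
  by have := inner_gVr (a i); rewrite ua0 mul0r => /esym/eqP; rewrite oner_eq0.
rewrite -[X in _ - X]mul1r -mulrBl mulf_eq0 (negPf q1) => /eqP mu0.
by rewrite mu0 scale0r addr0.
Qed.

(* [u (a_i)^-1 (u (x_i) + c_i u (a_i)) = c_i - v (x_i)] is an eigenvector of
   [a_i] for [q_i != 1], so a projection onto the [a_i]-invariants recovers
   [c_i] from [v (x_i)]; the same projection on [H], under conjugation, removes
   the contribution of the group elements. *)
Lemma inner_functional (c : 'I_n -> F) :
    (forall i g, act (g_ g) (u (x_ i) + c i *: u (g_ (a i)))
                 = chi i g *: (u (x_ i) + c i *: u (g_ (a i)))) ->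
  exists d : H -> F, [/\ scalar d, forall g, d (g_ g) = 0
    & forall i, d (x_ i) = c i].
Proof.
move=> cE; have q1 i : q i != 1 := qls_neq1 R i.
have [P [lP Pfix Pker]] := eigen_separation (enum 'I_n)
  (fun i => act_linearr act_action (g_ (a i)))
  (fun i j => inner_act_gC (a i) (a j)) q1.
pose C i (h : H) := g_ (a i) * h * g_ (a i)^-1%g.
have lC i : linear (C i).
  by move=> r s t; rewrite /C mulrDr mulrDl -scalerAr -scalerAl.
have CC i j h : C i (C j h) = C j (C i h).
  rewrite /C -!mulrA (mulrA (g_ (a i))) lifting_gC -!mulrA.
  by rewrite (lifting_gC D (a j)^-1%g).
have [E [lE Efix Eker]] := eigen_separation (enum 'I_n) lC CC q1.
exists (fun h => P (v (h - E h)) 0 0); split=> [r s t|g|i].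
- by rewrite lE opprD addrACA -scalerBr lv lP !mxE.
- rewrite Efix => [|i].
    by rewrite subrr (linfun_zero lv) (linfun_zero lP) mxE.
  by rewrite /C lifting_gC -mulrA lifting_gVr mulr1.
rewrite (Eker i) ?mem_enum ?subr0 //; last first.
  by rewrite /C lifting_gx -scalerAl -mulrA lifting_gVr mulr1.
have -> : v (x_ i) = (c i)%:A - v (g_ (a i)) * (u (x_ i) + c i *: u (g_ (a i))).
  by rewrite inner_x mulrDr -scalerAr inner_gVl opprD addrCA subrr addr0.
rewrite (linfun_sub lP) (linfun_scale lP) Pfix => [|j]; last first.
  by rewrite inner_act_g mulr1 inner_gVr.
rewrite (Pker i) ?mem_enum ?subr0 ?mxE ?eqxx ?mulr1 //.
rewrite inner_act_mul cE -scalerAr; congr (_ *: (_ * _)).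
by rewrite inner_act_g inner_gVr mul1r.
Qed.

End InnerAction.

(** * The conjugation formula and the normalized choice of [u] *)

Theorem theorem5p3 (F : fieldType) (gT : finGroupType)
    (gT_nontrivial : (1 < #|gT|)%N)
    (gT_dual : exists f : gT -> character F gT, bijective f)
    (n : nat) (R : qls F gT n) (D : compatible_datum R) (m : nat)
    (act : lifting D -> 'M[F]_m.+1 -> 'M[F]_m.+1)
    (u : {linear lifting D -> 'M[F]_m.+1})
    (act_action : module_algebra act) (act_inner : inner_via u act) :
  (forall i : 'I_n, exists lam : gT -> F, forall g : gT,
     u (lifting_g D g) * u (lifting_x D i) * (u (lifting_g D g))^-1
     = qls_chi R i g *: u (lifting_x D i)
       + lam g *: u (lifting_g D (qls_a R i)))
  /\ exists u' : {linear lifting D -> 'M[F]_m.+1},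
       inner_via u' act /\
       forall (g : gT) (i : 'I_n),
         u' (lifting_g D g) * u' (lifting_x D i)
         = qls_chi R i g *: (u' (lifting_x D i) * u' (lifting_g D g)).
Proof.
have [u1 [v [uv actE]]] := act_inner.
have gVl := inner_gVl uv; have act_g := inner_act_g actE.
split=> [i|].
  have [lam lamE] := boolp.choice (fun g => inner_conj_x act_action u1 uv actE g i).
  by exists lam => g; rewrite (inner_gV uv) -act_g lamE.
have [c cE] := boolp.choice (inner_eigen act_action u1 uv actE).
have [d [ld dg dx]] := inner_functional act_action u1 uv actE cE.
(* With values in the scalar matrices, the functional can be convolved with [u] and commutes with
   every matrix. *)
pose delta h : 'M[F]_m.+1 := (d h)%:A.
have ldelta : linear delta by move=> r s t; rewrite /delta ld scalerDl scalerA.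
have deltag g : delta (lifting_g D g) = 0 by rewrite /delta dg scale0r.
have [w [lw gw]] := conv_inverse_exists ldelta (convpow_nilpotent ldelta deltag).
pose gamma : lifting D -> 'M[F]_m.+1 := conv1 \+ delta.
have lgamma : linear gamma.
  by move=> r s t; rewrite /gamma /= ldelta conv1_linear scalerDr addrACA.
have gammag g : gamma (lifting_g D g) = 1.
  by rewrite /gamma /= deltag addr0 /conv1 lifting_counit_g scale1r.
have gamma1 : gamma 1 = 1 by rewrite -(lifting_g1 D).
have gammax i : gamma (lifting_x D i) = (c i)%:A.
  by rewrite /gamma /= /conv1 /delta dx lifting_counit_x scale0r add0r.
have gammaC h b : gamma h * b = b * gamma h.
  by rewrite /gamma /= /conv1 /delta -scalerDl -scalerAl -scalerAr mulr1 mul1r.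
have [u' [u'_inner u'E]] := inner_via_twist act_inner lgamma lw gw gamma1 gammaC.
have uB := conv_bilin (linearP u) lgamma.
have u'g g : u' (lifting_g D g) = u (lifting_g D g).
  by rewrite u'E /convolution lifting_comul_g tlift_tpure // gammag mulr1.
(* The coproduct of [x_i] turns the convolution into [u (x_i) * gamma 1 + u (a_i) * gamma (x_i)]. *)
have u'x i : u' (lifting_x D i)
    = u (lifting_x D i) + c i *: u (lifting_g D (qls_a R i)).
  rewrite u'E /convolution lifting_comul_x tliftD // !tlift_tpure //.
  by rewrite gamma1 gammax mulr1 -scalerAr mulr1.
(* By [cE] the right side is the conjugate of [u' (x_i)] by [u g], times [u g]. *)
exists u'; split=> // g i; rewrite u'g u'x scalerAl -cE act_g.
by rewrite -[RHS]mulrA gVl mulr1.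
Qed.
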